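(* There is a polynomial fpt-reduction from the model-checking problem for first-order logic $\mathrm{FO}$ on the class of all graphs to the model-checking problem for $\mathrm{FOC}(\{\mathsf{P}_=\})$ on the class of all trees.
   Context: Graphs are (undirected) graphs viewed as structures over the signature $\{E\}$ with a single binary relation symbol $E$; trees are graphs that are trees. The size of a structure $\mathcal{A}$ is $\|\mathcal{A}\|=|A|+\sum_R|R^{\mathcal{A}}|$ and the size $\|\varphi\|$ of a formula is its length. $\mathrm{FOC}(\{\mathsf{P}_=\})$ is the extension of first-order logic whose formulas and counting terms are built by: atomic formulas $x_1=x_2$, $R(x_1,\ldots,x_{\mathrm{ar}(R)})$; $\neg\varphi$, $(\varphi\vee\psi)$, $\exists y\,\varphi$; $\mathsf{P}_=(t_1,t_2)$ for counting terms $t_1,t_2$, which holds iff $t_1$ and $t_2$ have the same value; counting terms $\#(y_1,\ldots,y_k).\varphi$ (for pairwise distinct variables, $k\ge0$), whose value is the number of tuples $(a_1,\ldots,a_k)$ of elements that satisfy $\varphi$ when assigned to $(y_1,\ldots,y_k)$; integers; and $(t_1+t_2)$, $(t_1\cdot t_2)$. The model-checking problem for a logic $L$ on a class $\mathcal{C}$ of structures: given $\mathcal{A}\in\mathcal{C}$ and an $L$-sentence $\varphi$, decide whether $\mathcal{A}\models\varphi$. A polynomial fpt-reduction between two model-checking problems is a polynomial-time many-one reduction mapping an instance $(\mathcal{A},\varphi)$ to an instance $(\mathcal{A}',\varphi')$ such that $\|\mathcal{A}'\|$ is polynomially bounded in $\|\mathcal{A}\|$ and $\|\varphi'\|$ is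 polynomially bounded in $\|\varphi\|$. *)

(* Defs.v *)
From Corelib Require Import BinNums.
From mathcomp Require Import all_boot all_order all_algebra.

Set Implicit Arguments.
Unset Strict Implicit.
Unset Printing Implicit Defensive.

Import GRing.Theory.
Local Open Scope nat_scope.

(* Structures are finite and non-empty; since they are the inputs of
   algorithms, their universe is an initial segment {0, ..., n} of nat. *)
Record structure := Structure {
  max_elt : nat;
  edge : rel 'I_max_elt.+1
}.

Definition universe (A : structure) : finType := 'I_(max_elt A).+1.

Definition struct_size (A : structure) : nat :=
  #|universe A| + #|[set p : universe A * universe A | edge p.1 p.2]|.

Definition is_graph (A : structure) : Prop :=
  symmetric (@edge A) /\ irreflexive (@edge A).

(* A cycle is a duplicate-free cyclic sequence of at least 3 vertices: by
   symmetry of [edge], every edge x y yields the degenerate [ucycle] x y. *)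
Definition is_tree (A : structure) : Prop :=
  [/\ is_graph A,
      forall x y : universe A, connect (@edge A) x y
    & forall c : seq (universe A), ucycle (@edge A) c -> size c <= 2].

(* FOC({P_=}) over the signature {E}, with variables x_0, x_1, x_2, ...;
   FO is its fragment without P_=, hence without counting terms. *)
Inductive formula : Type :=
| Equal of nat & nat
| Edge of nat & nat
| Not of formula
| Or of formula & formula
| Exists of nat & formula
| SameValue of term & term
with term : Type :=
| Count (ys : seq nat) of uniq ys & formula
| Int of int
| Add of term & term
| Mul of term & term.

Fixpoint is_FO (phi : formula) : bool :=
  match phi with
  | Equal _ _ | Edge _ _ => true
  | Not phi1 => is_FO phi1
  | Or phi1 phi2 => is_FO phi1 && is_FO phi2
  | Exists _ phi1 => is_FO phi1
  | SameValue _ _ => false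
  end.

Definition FO : pred formula := is_FO.
Definition FOC : pred formula := predT.

Fixpoint free_vars (phi : formula) : seq nat :=
  match phi with
  | Equal x y | Edge x y => [:: x; y]
  | Not phi1 => free_vars phi1
  | Or phi1 phi2 => free_vars phi1 ++ free_vars phi2
  | Exists y phi1 => [seq x <- free_vars phi1 | x != y]
  | SameValue t1 t2 => term_free_vars t1 ++ term_free_vars t2
  end
with term_free_vars (t : term) : seq nat :=
  match t with
  | @Count ys _ phi => [seq x <- free_vars phi | x \notin ys]
  | Int _ => [::]
  | Add t1 t2 | Mul t1 t2 => term_free_vars t1 ++ term_free_vars t2
  end.

Definition sentence (phi : formula) : bool := nilp (free_vars phi).

(* beta with ys_i mapped to a_i, for duplicate-free ys with |ys| = |a| *)
Definition update (T : Type) (beta : nat -> T) (ys : seq nat) (a : seq T) :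
    nat -> T :=
  fun x => nth (beta x) a (index x ys).

Fixpoint sat (A : structure) (beta : nat -> universe A) (phi : formula) : bool :=
  match phi with
  | Equal x y => beta x == beta y
  | Edge x y => edge (beta x) (beta y)
  | Not phi1 => ~~ sat beta phi1
  | Or phi1 phi2 => sat beta phi1 || sat beta phi2
  | Exists y phi1 =>
      [exists a : universe A, sat (update beta [:: y] [:: a]) phi1]
  | SameValue t1 t2 => value beta t1 == value beta t2
  end
with value (A : structure) (beta : nat -> universe A) (t : term) : int :=
  match t with
  | @Count ys _ phi =>
      Posz #|[set a : (size ys).-tuple (universe A) | sat (update beta ys a) phi]|
  | Int z => z
  | Add t1 t2 => (value beta t1 + value beta t2)%R
  | Mul t1 t2 => (value beta t1 * value beta t2)%R
  end.

Definition models (A : structure) (phi : formula) : Prop :=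
  forall beta : nat -> universe A, sat beta phi.

(* Binary digits, least significant first, without leading zeros *)
Fixpoint pos_bits (p : positive) : seq bool :=
  match p with
  | xH => [:: true]
  | xO q => false :: pos_bits q
  | xI q => true :: pos_bits q
  end.

Definition nat_bits (n : nat) : seq bool :=
  match bin_of_nat n with
  | N0 => [::]
  | Npos p => pos_bits p
  end.

Inductive token : Type :=
| KVar of nat
| KEqual | KEdge | KNot | KOr | KExists | KSameValue
| KCount | KDot | KAdd | KMul
| KSign of bool  (* [true] for negative numerals *)
| KDigit of bool.

(* Polish notation.  A variable is a single symbol, whereas an integer is
   spelled out in binary, so that it contributes its number of digits. *)
Fixpoint word (phi : formula) : seq token :=
  match phi with
  | Equal x y => [:: KEqual; KVar x; KVar y]
  | Edge x y => [:: KEdge; KVar x; KVar y]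
  | Not phi1 => KNot :: word phi1
  | Or phi1 phi2 => KOr :: word phi1 ++ word phi2
  | Exists y phi1 => KExists :: KVar y :: word phi1
  | SameValue t1 t2 => KSameValue :: term_word t1 ++ term_word t2
  end
with term_word (t : term) : seq token :=
  match t with
  | @Count ys _ phi => KCount :: [seq KVar y | y <- ys] ++ KDot :: word phi
  | Int z => KSign (z < 0)%R :: [seq KDigit b | b <- nat_bits `|z|]
  | Add t1 t2 => KAdd :: term_word t1 ++ term_word t2
  | Mul t1 t2 => KMul :: term_word t1 ++ term_word t2
  end.

Definition formula_size (phi : formula) : nat := size (word phi).

Definition unary (n : nat) : seq bool := rcons (nseq n true) false.

(* No token code is a prefix of another one: a token starts with a unary tag,
   and the index of a variable is terminated by [false], each of its binary
   digits being preceded by [true]. *)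
Definition encode_token (k : token) : seq bool :=
  match k with
  | KVar n => unary 0 ++ flatten [seq [:: true; b] | b <- nat_bits n] ++ [:: false]
  | KEqual => unary 1
  | KEdge => unary 2
  | KNot => unary 3
  | KOr => unary 4
  | KExists => unary 5
  | KSameValue => unary 6
  | KCount => unary 7
  | KDot => unary 8
  | KAdd => unary 9
  | KMul => unary 10
  | KSign b => unary 11 ++ [:: b]
  | KDigit b => unary 12 ++ [:: b]
  end.

Definition encode_formula (phi : formula) : seq bool :=
  flatten [seq encode_token k | k <- word phi].

(* The number of elements in unary, then the adjacency matrix row by row *)
Definition encode_structure (A : structure) : seq bool :=
  unary #|universe A|
    ++ [seq edge i j | i <- enum (universe A), j <- enum (universe A)].

Definition encode (I : structure * formula) : seq bool :=
  encode_structure I.1 ++ encode_formula I.2.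

Inductive direction := GoLeft | GoRight | Stay.

(* The tape alphabet consists of a blank ([None]), the two bits used for input
   and output, and finitely many auxiliary symbols. *)
Definition cell (Gamma : Type) : Type := option (bool + Gamma).

(* A two-way infinite tape: the cells left of the head, nearest first, and the
   cells from the head on; all cells that are not listed are blank. *)
Definition tape (Gamma : Type) : Type := (seq (cell Gamma) * seq (cell Gamma))%type.

Definition tape_read (Gamma : Type) (t : tape Gamma) : cell Gamma := head None t.2.

Definition tape_write (Gamma : Type) (t : tape Gamma) (c : cell Gamma) :
    tape Gamma :=
  (t.1, c :: behead t.2).

Definition tape_move (Gamma : Type) (t : tape Gamma) (d : direction) :
    tape Gamma :=
  match d with
  | GoLeft => (behead t.1, head None t.1 :: t.2)
  | GoRight => (head None t.2 :: t.1, behead t.2)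
  | Stay => t
  end.

Record machine := Machine {
  state : finType;
  aux_symbol : finType;
  last_tape : nat;  (* there are [last_tape.+1] tapes *)
  start : state;
  halting : pred state;
  transition : state -> {ffun 'I_last_tape.+1 -> cell aux_symbol} ->
    state * {ffun 'I_last_tape.+1 -> cell aux_symbol * direction}
}.

Definition config (M : machine) : Type :=
  (state M * {ffun 'I_(last_tape M).+1 -> tape (aux_symbol M)})%type.

Definition step (M : machine) (c : config M) : config M :=
  if halting c.1 then c else
  let: (q, act) := transition c.1 [ffun i => tape_read (c.2 i)] in
  (q, [ffun i => tape_move (tape_write (c.2 i) (act i).1) (act i).2]).

Definition initial (M : machine) (w : seq bool) : config M :=
  (start M, [ffun i : 'I_(last_tape M).+1 =>
     ([::], if i == ord0 then [seq Some (inl b) | b <- w] else [::])]).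

Fixpoint leading_bits (Gamma : Type) (s : seq (cell Gamma)) : seq bool :=
  match s with
  | Some (inl b) :: s' => b :: leading_bits s'
  | _ => [::]
  end.

(* The output is the word on the last tape that extends from the head
   to the first cell that does not hold a bit. *)
Definition output (M : machine) (c : config M) : seq bool :=
  leading_bits (c.2 ord_max).2.

Definition outputs_within (M : machine) (w w' : seq bool) (time : nat) : Prop :=
  let c := iter time (@step M) (initial M w) in
  halting c.1 /\ output c = w'.

(* [x.[n]%R] is the value of the polynomial x at n. *)
Definition poly_bounded (T : Type) (D : T -> Prop) (f g : T -> nat) : Prop :=
  exists p : {poly nat}, forall x, D x -> f x <= p.[g x]%R.

Definition polytime_on (D : structure * formula -> Prop)
    (f : structure * formula -> structure * formula) : Prop :=
  exists (M : machine) (p : {poly nat}), forall I, D I ->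
    outputs_within M (encode I) (encode (f I)) p.[size (encode I)]%R.

Definition mc_instance (L : pred formula) (C : structure -> Prop)
    (I : structure * formula) : Prop :=
  [/\ C I.1, L I.2 & sentence I.2].

Definition polynomial_fpt_reduction
    (L : pred formula) (C : structure -> Prop)
    (L' : pred formula) (C' : structure -> Prop)
    (f : structure * formula -> structure * formula) : Prop :=
  let D := mc_instance L C in
  [/\ polytime_on D f,
      forall I, D I -> mc_instance L' C' (f I),
      forall I, D I -> (models I.1 I.2 <-> models (f I).1 (f I).2),
      poly_bounded D (fun I => struct_size (f I).1) (fun I => struct_size I.1)
    & poly_bounded D (fun I => formula_size (f I).2) (fun I => formula_size I.2)].

(* Main.v *)
(* The graph with rows r_0, ..., r_n is turned into a tree of height 3 with a
   child a_i of the root for each vertex i; a_i has i + 1 leaf children and, for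
   each edge {i, j}, a further child that has j + 1 leaf children.  In the tree,
   the number of leaf neighbours of a node is expressible by a counting term, so
   each node can stand for the vertex whose number it encodes in this way, and
   nodes without leaf neighbours can stand for the vertex 0.  Hence equality and
   adjacency of vertices become FOC({P_=})-definable relations on all nodes, and
   quantifiers need not be relativized: a formula is translated by replacing its
   atoms.  Each atom mentions its two variables just once, so the translation is
   a finite-state transduction of the Polish notation.  The tree is described by
   the depths of its nodes in preorder, from which a machine can read off the
   adjacency matrix row by row. *)
From HB Require Import structures.
From mathcomp Require Import all_boot all_order all_algebra zify.
Require Import Defs.

Set Implicit Arguments.
Unset Strict Implicit.
Unset Printing Implicit Defensive.

Import GRing.Theory.
Local Open Scope nat_scope.

(** * Translating formulas *)

(** Labels are shifted by one for two reasons. A child that records an edge is then never a leaf, so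
    it does not disturb the label of its parent; and a node without leaf neighbours is recognizable
    as unlabelled. The unlabelled nodes, which are the root and the leaves, must denote some vertex
    because quantifiers range over them, but their tree edges must not pass for graph edges. So a
    translated edge atom does not inspect the two nodes it is given: it asks for two adjacent nodes
    anywhere in the tree whose true, hence nonzero, leaf counts equal the labels of the given
    nodes. *)

Definition And (phi psi : formula) : formula := Not (Or (Not phi) (Not psi)).

Definition leaf_count (u : nat) : term :=
  @Count [:: 4] isT
    (And (Edge u 4) (SameValue (@Count [:: 6] isT (Edge 4 6)) (Int 1))).

(* The number of leaf neighbours, with 0 replaced by 1. *)
Definition label_term (u : nat) : term :=
  Add (leaf_count u) (@Count [::] isT (SameValue (leaf_count u) (Int 0))).

(* The two vertices are represented by the values of the variables 0 and 2.
   Auxiliary variables are even, those of the given formula become odd. *)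
Definition core (is_edge : bool) : formula :=
  if is_edge then
    Exists 8 (Exists 10 (And (Edge 8 10)
      (And (SameValue (leaf_count 8) (label_term 0))
           (SameValue (leaf_count 10) (label_term 2)))))
  else SameValue (label_term 0) (label_term 2).

(** In binary, a digit 1 is added at the low end. Indices are written with the least significant
    digit first, so the machine renames a variable by emitting one more digit. *)
Definition rename (x : nat) : nat := x.*2.+1.

Definition translate_atom (is_edge : bool) (x y : nat) : formula :=
  Exists 0 (And (Equal 0 (rename x))
    (Exists 2 (And (Equal 2 (rename y)) (core is_edge)))).

Fixpoint translate (phi : formula) : formula :=
  match phi with
  | Equal x y => translate_atom false x y
  | Edge x y => translate_atom true x y
  | Not phi1 => Not (translate phi1)
  | Or phi1 phi2 => Or (translate phi1) (translate phi2)
  | Exists y phi1 => Exists (rename y) (translate phi1)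
  | SameValue _ _ => phi
  end.

(** * Values of the counting terms *)

Definition degree (A : structure) (z : universe A) : nat :=
  #|[pred y : universe A | edge z y]|.

Definition leaf_neighbours (A : structure) (u : universe A) : nat :=
  #|[pred z : universe A | edge u z && (degree z == 1)]|.

Lemma sat_And (A : structure) (beta : nat -> universe A) phi psi :
  sat beta (And phi psi) = sat beta phi && sat beta psi.
Proof. by rewrite /= negb_or !negbK. Qed.

Lemma value_Count1 (A : structure) (beta : nat -> universe A) x (ux : uniq [:: x]) phi :
  value beta (Count ux phi) =
  Posz #|[pred a : universe A | sat (update beta [:: x] [:: a]) phi]|.
Proof.
rewrite [LHS]/=; congr Posz.
rewrite -(@card_image _ _ (fun a : universe A => [tuple a])) => [|a b [] //].
apply: eq_card => t; case/tupleP: t => a t; rewrite [t]tuple0 inE.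
apply/idP/imageP => [sat_a|[b sat_b /(congr1 val) [->]] //].
by exists a => //; apply: val_inj.
Qed.

(** There is exactly one 0-tuple, so a counting term without variables turns a truth value into 0 or
    1. *)
Lemma value_Count0 (A : structure) (beta : nat -> universe A) (u0 : uniq [::]) phi :
  value beta (Count u0 phi) = Posz (sat (update beta [::] [::]) phi).
Proof.
rewrite [LHS]/=; congr Posz; case Ephi: (sat (update beta [::] [::]) phi).
  by rewrite (eq_card (B := predT)) ?card_tuple // => t; rewrite !inE tuple0 Ephi.
by rewrite eq_card0 // => t; rewrite !inE tuple0 Ephi.
Qed.

Lemma value_leaf_count (A : structure) (beta : nat -> universe A) u :
  u != 4 -> u != 6 -> value beta (leaf_count u) = Posz (leaf_neighbours (beta u)).
Proof.
move=> u4 u6; rewrite /leaf_count value_Count1; congr Posz.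
apply: eq_card => z; rewrite !inE sat_And.
have Eu : update beta [:: 4] [:: z] u = beta u.
  by rewrite /update /= eq_sym (negbTE u4).
rewrite [sat _ (Edge _ _)]/= Eu; congr andb.
transitivity (value (update beta [:: 4] [:: z]) (@Count [:: 6] isT (Edge 4 6)) == 1%Z).
  by [].
by rewrite value_Count1 eqz_nat.
Qed.

Lemma update_nil (T : Type) (beta : nat -> T) x : update beta [::] [::] x = beta x.
Proof. by rewrite /update nth_nil. Qed.

Lemma value_label_term (A : structure) (beta : nat -> universe A) u :
  u != 4 -> u != 6 -> value beta (label_term u) = Posz (maxn 1 (leaf_neighbours (beta u))).
Proof.
move=> u4 u6; rewrite /label_term.
have -> : value beta (Add (leaf_count u) (@Count [::] isT (SameValue (leaf_count u) (Int 0))))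
  = (value beta (leaf_count u) + value beta (@Count [::] isT (SameValue (leaf_count u) (Int 0))))%R by [].
rewrite value_Count0 value_leaf_count //.
have -> : sat (update beta [::] [::]) (SameValue (leaf_count u) (Int 0)) =
  (value (update beta [::] [::]) (leaf_count u) == 0%R) by [].
rewrite value_leaf_count // update_nil eqz_nat -PoszD; congr Posz.
by case: (leaf_neighbours _) => // k; rewrite addn0 (maxn_idPr _).
Qed.

Lemma rename_neq x d : rename x == d.*2 = false.
Proof. by apply/eqP => /(congr1 odd); rewrite /rename /= !odd_double. Qed.

Lemma rename_inj : injective rename.
Proof. by move=> x y [] /double_inj. Qed.

Lemma sat_Exists (A : structure) (beta : nat -> universe A) x phi :
  sat beta (Exists x phi) =
  [exists a : universe A, sat (update beta [:: x] [:: a]) phi].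
Proof. by []. Qed.

Lemma sat_SameValue (A : structure) (beta : nat -> universe A) t1 t2 :
  sat beta (SameValue t1 t2) = (value beta t1 == value beta t2).
Proof. by []. Qed.

Lemma sat_translate_atom (A : structure) (beta : nat -> universe A) e x y :
  sat beta (translate_atom e x y) =
  sat (update (update beta [:: 0] [:: beta (rename x)]) [:: 2] [:: beta (rename y)]) (core e).
Proof.
rewrite /translate_atom sat_Exists.
have fresh (b : nat -> universe A) k a z : update b [:: k.*2] [:: a] (rename z) = b (rename z).
  by rewrite /update /= eq_sym rename_neq.
have fresh0 b a z : update b [:: 0] [:: a] (rename z) = b (rename z) := fresh b 0 a z.
have sat_eq (b : nat -> universe A) k a z :
    sat (update b [:: k.*2] [:: a]) (Equal k.*2 (rename z)) = (a == b (rename z)).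
  by rewrite [LHS]/= fresh /update /= eqxx.
apply/existsP/idP => [[a]|H].
  rewrite sat_And (sat_eq _ 0) sat_Exists => /andP [/eqP -> /existsP [b]].
  by rewrite sat_And (sat_eq _ 1) fresh0 => /andP [/eqP ->].
exists (beta (rename x)); rewrite sat_And (sat_eq _ 0) eqxx sat_Exists.
by apply/existsP; exists (beta (rename y)); rewrite sat_And (sat_eq _ 1) fresh0 eqxx.
Qed.

(** * Correctness of the translation *)

Definition vertex_of (A T : structure) (u : universe T) : universe A :=
  inord (leaf_neighbours u).-1.

(* The node [u] of [T] stands for the vertex of [A] whose successor is the
   number of leaf neighbours of [u], or for the vertex 0 if there are none. *)
Definition represents (A T : structure) : Prop :=
  [/\ forall a : universe A, exists u : universe T, leaf_neighbours u = a.+1,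
      forall u : universe T, leaf_neighbours u <= (max_elt A).+1
    & forall a b : universe A, edge a b <-> exists p q : universe T,
        [/\ edge p q, leaf_neighbours p = a.+1 & leaf_neighbours q = b.+1]].

(** The truncated predecessor and [maxn 1] treat a node without leaf neighbours alike, as if it had
    one. The upper bound in [represents] keeps [inord] away from its default. *)
Lemma vertex_ofS (A T : structure) (u : universe T) : represents A T ->
  maxn 1 (leaf_neighbours u) = (vertex_of A u).+1.
Proof.
case=> _ label_le _; rewrite /vertex_of /= inordK.
  by case: (leaf_neighbours u) => // k; exact/maxn_idPr.
by have := label_le u; case: (leaf_neighbours u).
Qed.

(** The edge witnesses are measured by [leaf_count], not by [label_term]: otherwise the edges
    between the root and its children would be read as edges at vertex 0. *)
Lemma sat_core (A T : structure) (beta : nat -> universe T) e : represents A T ->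
  sat beta (core e) =
  if e then edge (vertex_of A (beta 0)) (vertex_of A (beta 2))
  else vertex_of A (beta 0) == vertex_of A (beta 2).
Proof.
move=> rep; have [_ _ edge_label] := rep.
case: e; last first.
  by rewrite sat_SameValue !value_label_term // !(vertex_ofS _ rep) eqz_nat eqSS.
rewrite [core _]/= sat_Exists; apply/existsP/idP => [[p]|/edge_label [p [q [Epq Ep Eq]]]].
  rewrite sat_Exists => /existsP [q]; rewrite !sat_And !sat_SameValue => /and3P [Epq].
  rewrite !value_label_term // !value_leaf_count // !(vertex_ofS _ rep).
  by move=> /eqP [Ep] /eqP [Eq]; apply/edge_label; exists p, q.
exists p; rewrite sat_Exists; apply/existsP; exists q; rewrite !sat_And !sat_SameValue.
rewrite !value_label_term // !value_leaf_count // !(vertex_ofS _ rep).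
by apply/and3P; split=> //; apply/eqP; congr Posz.
Qed.

Lemma vertex_of_onto (A T : structure) : represents A T ->
  forall a : universe A, exists u : universe T, vertex_of A u = a.
Proof.
move=> rep a; have [/(_ a) [u lu] _ _] := rep; exists u.
by apply: val_inj; apply: succn_inj; rewrite /= -(vertex_ofS u rep) lu; exact/maxn_idPr.
Qed.

(** [vertex_of] is onto and the translated atoms are the preimages of the original ones, so
    quantifiers lift along it as along a surjective strong homomorphism. *)
Lemma sat_translate (A T : structure) phi
    (beta : nat -> universe A) (beta' : nat -> universe T) :
  represents A T -> is_FO phi ->
  (forall x, beta x = vertex_of A (beta' (rename x))) ->
  sat beta' (translate phi) = sat beta phi.
Proof.
move=> rep.
elim: phi beta beta' => [x y|x y|phi IH|phi IHl psi IHr|y phi IH|t1 t2] beta beta' //.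
- by move=> _ E; rewrite [translate _]/= sat_translate_atom (sat_core _ _ rep) /= !E.
- by move=> _ E; rewrite [translate _]/= sat_translate_atom (sat_core _ _ rep) /= !E.
- by move=> FOphi E; congr negb; exact: IH.
- by move=> /andP [FOl FOr] E; congr orb; [exact: IHl | exact: IHr].
move=> FOphi E; rewrite [translate _]/= !sat_Exists.
have Eu a u : vertex_of A u = a ->
    forall x, update beta [:: y] [:: a] x =
      vertex_of A (update beta' [:: rename y] [:: u] (rename x)).
  move=> <- x; rewrite /update /= (inj_eq rename_inj).
  by case: eqP => // _; exact: E.
apply/existsP/existsP => [[u sat_u]|[a sat_a]].
  by exists (vertex_of A u); rewrite -(IH _ _ FOphi (Eu _ _ erefl)).
have [u Ea] := vertex_of_onto rep a; exists u.
by rewrite (IH _ _ FOphi (Eu _ _ Ea)).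
Qed.

Lemma models_translate (A T : structure) phi : represents A T -> is_FO phi ->
  models A phi <-> models T (translate phi).
Proof.
move=> rep FOphi; split=> H beta.
  by rewrite (sat_translate (beta := fun x => vertex_of A (beta (rename x))) rep FOphi).
have ex x : exists u : universe T, vertex_of A u == beta x.
  by have [u <-] := vertex_of_onto rep (beta x); exists u.
(* Halving undoes [rename], so [rename x] receives a chosen preimage of [beta x]. *)
pose beta' y := xchoose (ex y./2).
rewrite -(sat_translate (beta' := beta') rep FOphi) // => x.
have /eqP {1}<- := xchooseP (ex x); rewrite /beta' /rename.
by rewrite -[x.*2.+1]/(true + x.*2) half_bit_double.
Qed.

Lemma free_vars_translate phi : is_FO phi ->
  free_vars (translate phi) = [seq rename x | x <- free_vars phi].
Proof.
have E x d : (rename x != d.*2) = true by rewrite rename_neq.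
have atom e x y : free_vars (translate_atom e x y) = [:: rename x; rename y].
  have E0 z : (rename z != 0) = true := E z 0.
  have E2 z : (rename z != 2) = true := E z 1.
  by case: e; rewrite /translate_atom /=; rewrite ?(E0, E2) /= ?(E0, E2).
elim: phi => [x y|x y|phi IH|phi IHl psi IHr|y phi IH|t1 t2] //.
- by move=> _; rewrite [translate _]/= atom.
- by move=> _; rewrite [translate _]/= atom.
- by move=> /andP [/IHl El /IHr Er]; rewrite /= El Er map_cat.
move=> /IH Ephi; rewrite /= Ephi filter_map; congr map; apply: eq_filter => x.
by rewrite /= (inj_eq rename_inj).
Qed.

(** * Trees given by the depths of their nodes in preorder *)

Fixpoint column_word (j : nat) (bits : seq bool) : seq nat :=
  if bits is b :: bits' then
    (if b then 2 :: nseq j.+1 3 else [::]) ++ column_word j.+1 bits'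
  else [::].

Fixpoint row_word (i : nat) (rows : seq (seq bool)) : seq nat :=
  if rows is bits :: rows' then
    (1 :: nseq i.+1 2) ++ column_word 0 bits ++ row_word i.+1 rows'
  else [::].

(* The prefix [:: 1; 2] duplicates the node of vertex 0, so that the root is not
   a leaf when the graph has only one vertex. *)
Definition tree_word (rows : seq (seq bool)) : seq nat :=
  [:: 0, 1, 2 & row_word 0 rows].

(* The entries right of the diagonal in the row of a node of depth [d] that is
   followed by [v]; those left of the diagonal, from right to left, when the
   node is preceded by [rev u]. *)
Fixpoint right_bits (d : nat) (v : seq nat) : seq bool :=
  if v is x :: v' then
    if x <= d then nseq (size v') .+1 false
    else (x == d.+1) :: right_bits d v'
  else [::].

Fixpoint left_bits (d : nat) (u : seq nat) : seq bool :=
  if u is x :: u' then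
    if x < d then (x.+1 == d) :: nseq (size u') false
    else false :: left_bits d u'
  else [::].

Definition matrix_row (u : seq nat) (d : nat) (v : seq nat) : seq bool :=
  rev (left_bits d (rev u)) ++ false :: right_bits d v.

Fixpoint matrix_rows (u v : seq nat) : seq bool :=
  if v is d :: v' then matrix_row u d v' ++ matrix_rows (rcons u d) v'
  else [::].

(** * Parents in a depth sequence and the adjacency matrix *)

Lemma size_right_bits d v : size (right_bits d v) = size v.
Proof.
elim: v => //= x v IH; case: ifP => //= _; last by rewrite IH.
by rewrite size_nseq.
Qed.

Lemma nth_right_bits d v k :
  nth false (right_bits d v) k = (nth 0 v k == d.+1) && all (ltn d) (take k v).
Proof.
elim: v k => [|x v IH] [|k] //=.
  by case: leqP => H /=; [lia | rewrite andbT].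
case: leqP => [le_xd|lt_dx] /=; last by rewrite IH.
by rewrite nth_nseq if_same andbF.
Qed.

(** The parent relation: in preorder, the proper descendants of a node are the maximal run of deeper
    entries right after it. *)
Definition down (w : seq nat) (r c : nat) : bool :=
  [&& r < c, nth 0 w c == (nth 0 w r).+1 &
      all (ltn (nth 0 w r)) (take (c - r.+1) (drop r.+1 w))].

Definition adjacent (w : seq nat) (r c : nat) : bool := down w r c || down w c r.

Lemma down_right_bits w r c : r < c ->
  down w r c = nth false (right_bits (nth 0 w r) (drop r.+1 w)) (c - r.+1).
Proof. by move=> lt_rc; rewrite /down lt_rc nth_right_bits nth_drop subnKC. Qed.

Lemma down_lt w r c : down w r c -> r < c.
Proof. by case/and3P. Qed.

Lemma down_size w r c : down w r c -> c < size w.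
Proof.
case/and3P=> _ /eqP Ec _; rewrite ltnNge; apply/negP => le_wc.
by rewrite nth_default in Ec.
Qed.

Lemma down_between w r c k : down w r c -> r < k < c -> nth 0 w r < nth 0 w k.
Proof.
move=> Drc /andP [lt_rk lt_kc]; have lt_cw := down_size Drc.
case/and3P: Drc => lt_rc _ /all_nthP H.
have lt_k : k - r.+1 < c - r.+1 by lia.
have := H 0 (k - r.+1); rewrite nth_take // nth_drop subnKC //; apply.
by rewrite size_takel // size_drop; lia.
Qed.

(** Induction from the right end. If the last entry p is below d, it hides every earlier candidate
    x, which would need x < p < d = x + 1. *)
Lemma left_bitsE u d :
  rev (left_bits d (rev u)) =
  [seq (d == (nth 0 u c).+1) && all (ltn (nth 0 u c)) (drop c.+1 u) | c <- iota 0 (size u)].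
Proof.
elim/last_ind: u => // u p IH.
rewrite rev_rcons size_rcons -addn1 iotaD map_cat /= add0n cats1 nth_rcons ltnn eqxx.
rewrite drop_oversize ?size_rcons //= andbT.
have E c : c < size u -> nth 0 (rcons u p) c = nth 0 u c /\
    drop c.+1 (rcons u p) = rcons (drop c.+1 u) p.
  move=> lt_c; rewrite nth_rcons lt_c -!cats1 drop_cat; split=> //.
  case: ltnP => // le_uc; have -> : c.+1 - size u = 0 by lia.
  by rewrite drop0 [drop c.+1 u]drop_oversize; last lia.
case: ifP => lt_pd; rewrite rev_cons; last first.
  rewrite IH [d == _](_ : _ = false); last by apply/eqP; lia.
  congr rcons; apply/eq_in_map => c; rewrite mem_iota add0n => /E [-> ->].
  rewrite all_rcons; case: eqP => //= Ed; rewrite [_ < p](_ : _ = true) //; lia.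
rewrite [d == _]eq_sym; congr rcons.
have -> : [seq (d == (nth 0 (rcons u p) c).+1) && all (ltn (nth 0 (rcons u p) c))
    (drop c.+1 (rcons u p)) | c <- iota 0 (size u)] = [seq false | c <- iota 0 (size u)].
  apply/eq_in_map => c; rewrite mem_iota add0n => /E [-> ->]; rewrite all_rcons.
  by apply/negbTE; apply/negP => /and3P [/eqP Ed]; rewrite /=; lia.
rewrite size_rev rev_nseq; elim: (size u) 0 => //= n IHn k; congr cons; exact: IHn.
Qed.

Lemma matrix_rowE u d v :
  matrix_row u d v =
  [seq adjacent (u ++ d :: v) (size u) c | c <- iota 0 (size (u ++ d :: v))].
Proof.
set w := u ++ d :: v.
have dep_r : nth 0 w (size u) = d by rewrite nth_cat ltnn subnn.
have drop_r k t : k = size u -> drop k.+1 (u ++ d :: t) = t.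
  by move=> ->; rewrite drop_cat ltnNge leqnSn subSnn /= drop0.
have nlt_down r c : c <= r -> down w r c = false by move=> H; rewrite /down ltnNge H.
rewrite size_cat iotaD map_cat /= add0n; congr (_ ++ _ :: _).
- rewrite left_bitsE; apply/eq_in_map => c; rewrite mem_iota add0n => /andP [_ lt_c].
  rewrite /adjacent nlt_down ?(ltnW lt_c) //= /down lt_c dep_r nth_cat lt_c.
  congr (_ && all _ _); rewrite /w drop_cat; case: ltnP => [lt|le].
    by rewrite take_size_cat // size_drop.
  have Ec : c.+1 = size u by lia.
  by rewrite Ec subnn take0 drop_size.
- by rewrite /adjacent nlt_down.
apply: (@eq_from_nth _ false); rewrite size_right_bits ?size_map ?size_iota // => k lt_k.
rewrite (nth_map 0) ?size_iota // nth_iota // /adjacent [down w (_ + _) _]nlt_down; last by lia.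
rewrite orbF down_right_bits ?dep_r ?drop_r //; last by lia.
by congr nth; lia.
Qed.

Lemma matrix_rowsE w :
  matrix_rows [::] w = [seq adjacent w i j | i <- iota 0 (size w), j <- iota 0 (size w)].
Proof.
suff H u v : matrix_rows u v = [seq adjacent (u ++ v) i j
    | i <- iota (size u) (size v), j <- iota 0 (size (u ++ v))] by exact: H [::] w.
elim: v u => //= d v IH u; rewrite matrix_rowE IH size_rcons cat_rcons.
by [].
Qed.

(** * Structures of depth sequences are trees *)

Definition word_structure (w : seq nat) : structure :=
  Structure (fun i j : 'I_(size w).-1.+1 => adjacent w i j).

Lemma card_word_structure w : 0 < size w -> #|universe (word_structure w)| = size w.
Proof. by move=> w_gt0; rewrite card_ord /= prednK. Qed.

Lemma encode_word_structure w : 0 < size w ->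
  encode_structure (word_structure w) = unary (size w) ++ matrix_rows [::] w.
Proof.
move=> w_gt0; rewrite /encode_structure card_word_structure // matrix_rowsE.
congr (_ ++ _).
have <- : [seq val i | i <- enum (universe (word_structure w))] = iota 0 (size w).
  by rewrite -[in RHS](prednK w_gt0) val_enum_ord.
by rewrite allpairs_mapl; congr flatten; apply: eq_map => i; rewrite -map_comp.
Qed.

(* A depth sequence of a preorder traversal of a tree. *)
Definition tree_like (w : seq nat) : Prop :=
  [/\ 0 < size w, nth 0 w 0 = 0,
      forall c, 0 < c < size w -> 0 < nth 0 w c
    & forall c, c.+1 < size w -> nth 0 w c.+1 <= (nth 0 w c).+1].

(** Of two parents, the later one would lie between the earlier one and the node and hence be
    strictly deeper, whereas both have depth one less than the node. *)
Lemma down_uniq w r r' c : down w r c -> down w r' c -> r = r'.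
Proof.
move=> D D'; have lt := down_lt D; have lt' := down_lt D'.
have [/and3P [_ /eqP E _] /and3P [_ /eqP E' _]] := (D, D').
case: (ltngtP r r') => // H.
  by have := down_between D (_ : r < r' < c); rewrite H lt' => /(_ isT); lia.
by have := down_between D' (_ : r' < r < c); rewrite H lt => /(_ isT); lia.
Qed.

(** The parent is the last earlier position of smaller depth. Its successor is already at least as
    deep as [c], and depths rise by at most one per step, so the difference is exactly 1. *)
Lemma down_exists w c : tree_like w -> 0 < c < size w -> exists r, down w r c.
Proof.
case=> w_gt0 root pos incr /andP [c_gt0 lt_cw].
pose P r := (r < c) && (nth 0 w r < nth 0 w c).
have exP : exists r, P r by exists 0; rewrite /P c_gt0 root pos ?c_gt0.
have ubP r : P r -> r <= c by case/andP=> /ltnW.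
case: (ex_maxnP exP ubP) => r /andP [lt_rc lt_dep] maxr; exists r.
have dep_ge k : r < k < c -> nth 0 w c <= nth 0 w k.
  move=> /andP [lt_rk lt_kc]; rewrite leqNgt; apply/negP => H.
  by have := maxr k; rewrite /P lt_kc H => /(_ isT); lia.
have dep_r : nth 0 w c = (nth 0 w r).+1.
  have := incr r; case: (ltnP r.+1 c) => [lt|le].
    have := dep_ge r.+1; rewrite lt ltnSn => /(_ isT); lia.
  have -> : r.+1 = c by lia.
  lia.
rewrite /down lt_rc dep_r eqxx /=; apply/(all_nthP 0) => k.
rewrite size_takel ?size_drop => [lt_k|]; last by lia.
rewrite nth_take // nth_drop /=; have := dep_ge (r.+1 + k); lia.
Qed.

(** Following parents leads from any node to position 0. On a cycle, both neighbours of the last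
    position are earlier, hence both are its parent; so they coincide, which is impossible on a
    cycle of length at least 3. *)
Lemma word_structure_tree w : tree_like w -> is_tree (word_structure w).
Proof.
move=> tw; have [w_gt0 _ _ _] := tw.
have symE : symmetric (@edge (word_structure w)).
  by move=> x y /=; rewrite /adjacent orbC.
have irrE : irreflexive (@edge (word_structure w)).
  by move=> x; rewrite /= /adjacent /down ltnn.
split=> [//|x y|c /andP [cyc uniq_c]].
- have conn0 z : connect (@edge (word_structure w)) ord0 z.
    case: z => z; elim/ltn_ind: z => z IH lt_z.
    case: (posnP z) => [z0|z_gt0].
      by rewrite (_ : Ordinal _ = ord0) //; apply: val_inj.
    have lt_zw : z < size w by move: lt_z; rewrite /= prednK.
    have [|r Dr] := @down_exists w z tw; first by rewrite z_gt0.
    have lt_rz := down_lt Dr; have lt_r := ltn_trans lt_rz lt_z.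
    apply: connect_trans (IH r lt_rz lt_r) (connect1 _).
    by rewrite /= /adjacent Dr.
  apply: connect_trans (conn0 y).
  by rewrite (sym_connect_sym symE).
rewrite leqNgt; apply/negP => size_c.
have [x cx] : exists x, x \in c by case: (c) size_c => // x s _; exists x; rewrite mem_head.
pose m := [arg max_(y > x in c) val y].
have [cm maxm] : m \in c /\ forall y, y \in c -> val y <= val m.
  by rewrite /m; case: arg_maxnP.
have below y : y \in c -> edge m y -> down w y m.
  move=> /maxm le_ym /orP [/down_lt|//]; rewrite ltnNge => /negP; case; exact: le_ym.
(* Once the cycle is rotated to start at [m], the neighbours of [m] are the second and the last
   entry. *)
case/rot_to: cm => i s Es.
have cm y : (y \in c) = (y \in m :: s) by rewrite -Es mem_rot.
move: cyc uniq_c size_c; rewrite -(rot_cycle i) -(rot_uniq i) -(size_rot i) Es.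
case: s Es cm => [|y s] // _ cm /=; rewrite rcons_path => /and3P [Emy _ Elast].
move=> /and3P [_ ynots _]; rewrite !ltnS => s_gt0.
have : val y = val (last y s).
  apply: (@down_uniq w _ _ m); apply: below.
  - by rewrite cm !in_cons eqxx orbT.
  - exact: Emy.
  - by rewrite cm in_cons mem_last orbT.
  by rewrite symE.
move/val_inj=> Ey; case/negP: ynots; rewrite {1}Ey {Ey Emy Elast cm}.
by case: s s_gt0 => // a t _; exact: (mem_last a t).
Qed.

(* The children of a node of depth [d], where [v] is the part of the word that
   follows the node; a node is given by the suffix that starts with it. *)
Fixpoint kids (d : nat) (v : seq nat) : seq (seq nat) :=
  if v is x :: v' then
    if x <= d then [::] else (if x == d.+1 then [:: v] else [::]) ++ kids d v'
  else [::].

Definition children (s : seq nat) : seq (seq nat) := kids (head 0 s) (behead s).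

Definition leaf_children (s : seq nat) : nat :=
  count (fun t => nilp (children t)) (children s).

(** Nodes are identified with nonempty suffixes, so this is a search through all nodes. *)
Fixpoint somewhere (P : pred (seq nat)) (s : seq nat) : bool :=
  if s is _ :: s' then P s || somewhere P s' else false.

Lemma somewhereP (P : pred (seq nat)) s :
  reflect (exists2 r, r < size s & P (drop r s)) (somewhere P s).
Proof.
elim: s => [|x s IH]; first by right=> -[].
apply: (iffP orP) => [[Ps|/IH [r lt_r Pr]]|[[|r] lt_r Pr]].
- by exists 0.
- by exists r.+1.
- by left.
by right; apply/IH; exists r.
Qed.

Lemma kids_drop d v :
  kids d v = [seq drop c v | c <- iota 0 (size v) & nth false (right_bits d v) c].
Proof.
elim: v => //= x v IH; case: leqP => [_|lt_dx].
  rewrite -[_ :: nseq _ _]/(nseq (size v).+1 false) (eq_in_filter (a2 := pred0)) ?filter_pred0 //.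
  by move=> c _; rewrite nth_nseq if_same.
rewrite -[1]addn0 iotaDl filter_map IH.
by case: (x == d.+1); rewrite /= -map_comp.
Qed.

Lemma children_drop w r : r < size w ->
  children (drop r w) = [seq drop c w | c <- iota 0 (size w) & down w r c].
Proof.
move=> lt_r; rewrite /children (drop_nth 0 lt_r) /= kids_drop size_drop.
have Ew : size w = r.+1 + (size w - r.+1) by rewrite subnKC.
rewrite {2}Ew iotaD filter_cat [in RHS](eq_in_filter (a1 := down w r) (a2 := pred0)) ?filter_pred0; last first.
  by move=> c; rewrite mem_iota add0n ltnS /= => le_c; rewrite /down ltnNge le_c.
have -> : iota (0 + r.+1) (size w - r.+1) = [seq r.+1 + i | i <- iota 0 (size w - r.+1)].
  by rewrite -iotaDl addn0.
rewrite filter_map -map_comp.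
rewrite (eq_map (g := drop^~ w \o addn r.+1)); last by move=> c; rewrite /= drop_drop addnC.
congr map; apply: eq_filter => c.
by rewrite /= down_right_bits ?leq_addr // addKn.
Qed.

(** * Degrees and leaf neighbours *)

Lemma card_nat_pred n (P : pred nat) : #|[pred i : 'I_n | P i]| = count P (iota 0 n).
Proof. by rewrite cardE /enum_mem size_filter -enumT -val_enum_ord count_map. Qed.

Lemma card_children w (u : universe (word_structure w)) (P : pred (seq nat)) :
  0 < size w ->
  #|[pred z : universe (word_structure w) | down w u z && P (drop z w)]| =
  count P (children (drop u w)).
Proof.
move=> w_gt0; rewrite children_drop; last by rewrite -[size w]prednK.
rewrite count_map count_filter (@card_nat_pred _ (fun z => down w u z && P (drop z w))).
move: (nat_of_ord u) => r; rewrite prednK //.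
by apply: eq_count => c /=; rewrite andbC.
Qed.

Lemma card_parents w (z : universe (word_structure w)) : tree_like w ->
  #|[pred r : universe (word_structure w) | down w r z]| = (0 < z).
Proof.
move=> tw; have [w_gt0 _ _ _] := tw.
have lt_z : z < size w by rewrite -[size w]prednK.
case: posnP => [z0|z_gt0]; first by rewrite eq_card0 // => r; rewrite inE /down z0 ltn0.
have [|r Dr] := @down_exists w z tw; first by rewrite z_gt0.
have lt_r : r < (size w).-1.+1 by rewrite prednK // (ltn_trans (down_lt Dr)).
rewrite (eq_card (B := pred1 (Ordinal lt_r : universe (word_structure w)))) ?card1 // => r'.
rewrite !inE; apply/idP/eqP => [D|->] //; apply: val_inj; exact: (down_uniq D Dr).
Qed.

Lemma card_neighbours w (u : universe (word_structure w)) (P : pred nat) :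
  #|[pred z : universe (word_structure w) | edge u z && P z]| =
  #|[pred z : universe (word_structure w) | down w u z && P z]| +
  #|[pred z : universe (word_structure w) | down w z u && P z]|.
Proof.
rewrite -cardUI [X in _ + X]eq_card0 ?addn0 => [|z].
  by apply: eq_card => z; rewrite !inE /= /adjacent andb_orl.
rewrite !inE; apply/negP => /andP [/andP [/down_lt lt_uz _] /andP [/down_lt lt_zu _]].
by move: (ltn_trans lt_uz lt_zu); rewrite ltnn.
Qed.

Lemma degree_word w (z : universe (word_structure w)) : tree_like w ->
  degree z = size (children (drop z w)) + (0 < z).
Proof.
move=> tw; have [w_gt0 _ _ _] := tw.
transitivity #|[pred y : universe (word_structure w) | edge z y && predT (val y)]|.
  by apply: eq_card => y; rewrite !inE andbT.
rewrite card_neighbours -(card_parents z tw) -[size _]count_predT -card_children //.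
by congr (_ + _); apply: eq_card => y; rewrite !inE andbT.
Qed.

(** A parent is never a leaf: below the root it has a child and a parent itself, and the root has at
    least two children by hypothesis. So only children contribute, and these are leaves exactly when
    they are childless. *)
Lemma leaf_neighbours_word w (u : universe (word_structure w)) :
  tree_like w -> 1 < size (children w) ->
  leaf_neighbours u = leaf_children (drop u w).
Proof.
move=> tw root; have [w_gt0 _ _ _] := tw.
rewrite /leaf_children -card_children //.
pose P z := size (children (drop z w)) + (0 < z) == 1.
have := card_neighbours u P.
(* The summand that vanishes counts parents of degree 1. *)
rewrite [X in _ + X]eq_card0 ?addn0 => [E|z].
  rewrite /leaf_neighbours; have -> : #|[pred z | edge u z && (degree z == 1)]| =
      #|[pred z : universe (word_structure w) | edge u z && P z]|.
    by apply: eq_card => z; rewrite !inE degree_word.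
  rewrite E; apply: eq_card => z; rewrite !inE /P; case D: (down _ _ _) => //=.
  by rewrite (leq_trans _ (down_lt D)) // addn1 eqSS.
rewrite !inE; apply/negP => /andP [D]; rewrite /P.
have kz : 0 < size (children (drop z w)).
  rewrite -[size _]count_predT -card_children //; apply/card_gt0P; exists u.
  by rewrite !inE D.
case: posnP => [z0|_]; last by rewrite addn1 eqSS => /eqP E; rewrite E in kz.
by rewrite z0 drop0 addn0 => /eqP E; rewrite E in root.
Qed.

(** * Leaf children in the tree of a matrix *)

Lemma kids_low d t : head 0 t <= d -> kids d t = [::].
Proof. by case: t => //= x t ->. Qed.

Lemma kids_skip d v t : all (ltn d.+1) v -> kids d (v ++ t) = kids d t.
Proof.
elim: v => //= x v IH /andP [lt_dx /IH ->]; case: leqP => [|_]; first by lia.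
by rewrite gtn_eqF.
Qed.

Definition is_leaf (s : seq nat) : bool := nilp (children s).

Lemma leaf_children_leaf s : is_leaf s -> leaf_children s = 0.
Proof. by move/nilP=> E; rewrite /leaf_children E. Qed.

(** A repeated depth leaves the earlier node childless, and the bound on [head 0 t] does the same
    for the last one; the default 0 covers an empty [t]. *)
Lemma is_leaf_nseq d k t : head 0 t <= d -> is_leaf (nseq k.+1 d ++ t).
Proof. by move=> low_t; rewrite /is_leaf /children /= kids_low //; case: k => /=. Qed.

Lemma kids_nseq d k t : head 0 t <= d.+1 ->
  exists l, [/\ kids d (nseq k d.+1 ++ t) = l ++ kids d t, size l = k & all is_leaf l].
Proof.
move=> low_t; elim: k => [|k [l [El sl al]]]; first by exists [::].
exists ((nseq k.+1 d.+1 ++ t) :: l); rewrite /= sl al ltnn eqxx El; split=> //.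
by rewrite andbT (is_leaf_nseq k).
Qed.

Lemma leaf_children_nseq d k t : head 0 t <= d ->
  leaf_children (d :: nseq k d.+1 ++ t) = k /\ all is_leaf (children (d :: nseq k d.+1 ++ t)).
Proof.
move=> low_t; have [|l [El sl al]] := @kids_nseq d k t; first exact: leqW.
rewrite /leaf_children /children /= El kids_low // cats0; split=> //.
by rewrite -sl; apply/eqP; rewrite -all_count.
Qed.

Lemma has_leaf n l : all is_leaf l -> has (fun s => leaf_children s == n.+1) l = false.
Proof. by elim: l => //= s l IH /andP [/leaf_children_leaf -> /IH ->]. Qed.

Lemma low_column j s t : head 0 t <= 2 -> head 0 (column_word j s ++ t) <= 2.
Proof. by move=> low_t; elim: s j => //= -[] s IH j //=. Qed.

Lemma low_row i rows : head 0 (row_word i rows) <= 1.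
Proof. by case: rows. Qed.

Lemma column_word_true j s t :
  column_word j (true :: s) ++ t = 2 :: nseq j.+1 3 ++ column_word j.+1 s ++ t.
Proof. by rewrite /= -catA. Qed.

(** A column node with index j has j + 1 leaves, so it is not a leaf itself and does not count
    towards the label of its row. *)
Lemma kids_column j s t n : head 0 t <= 1 ->
  has is_leaf (kids 1 (column_word j s ++ t)) = false /\
  has (fun r => leaf_children r == n.+1) (kids 1 (column_word j s ++ t)) =
    (j <= n) && nth false s (n - j).
Proof.
move=> low_t; elim: s j => [|b s IH] j; first by rewrite /= kids_low // nth_nil andbF.
have low2 : head 0 (column_word j.+1 s ++ t) <= 2 by apply: low_column; exact: leqW.
have [IH1 IH2] := IH j.+1.
have Enth c : (j < n) && nth c s (n - j.+1) = (j < n) && nth c (b :: s) (n - j).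
  by case: (ltnP j n) => //= lt_jn; rewrite -[n - j]prednK ?subn_gt0 // subnS.
case: b Enth => Enth; last first.
  by rewrite /= IH1 IH2 Enth; split=> //; case: ltngtP => // ->; rewrite subnn.
have [E al] := leaf_children_nseq j.+1 low2.
rewrite column_word_true; set r := 2 :: _.
have -> : kids 1 r = r :: kids 1 (column_word j.+1 s ++ t).
  by rewrite -[in RHS](@kids_skip 1 (nseq j.+1 3)) // all_nseq orbT.
split; first by rewrite /= IH1.
by rewrite /= IH2 Enth E eqSS; case: ltngtP => // ->; rewrite subnn.
Qed.

Lemma row_word_cons i s rows :
  row_word i (s :: rows) = 1 :: nseq i.+1 2 ++ column_word 0 s ++ row_word i.+1 rows.
Proof. by []. Qed.

(** The leaves that form the label have no leaf children, and the column nodes are no leaves, so the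
    code of the vertex and the codes of its neighbours do not interfere. *)
Lemma children_row i s t n : head 0 t <= 1 ->
  let r := 1 :: nseq i.+1 2 ++ column_word 0 s ++ t in
  [/\ leaf_children r = i.+1, is_leaf r = false
    & has (fun r => leaf_children r == n.+1) (children r) = nth false s n].
Proof.
move=> low_t r.
have low2 : head 0 (column_word 0 s ++ t) <= 2 by apply: low_column; exact: leqW.
have [l [El sl al]] := kids_nseq i.+1 low2.
have [c1 c2] := kids_column 0 s n low_t.
have Er : children r = l ++ kids 1 (column_word 0 s ++ t) by rewrite -El.
split.
- rewrite /leaf_children Er count_cat -sl.
  rewrite [X in _ + X](_ : _ = 0); last by apply/eqP; rewrite -leqn0 leqNgt -has_count c1.
  by rewrite addn0; apply/eqP; rewrite -all_count.
- by rewrite /is_leaf Er; case: l sl {El al Er}.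
- by rewrite Er has_cat has_leaf //= c2 subn0.
Qed.

Lemma kids_rows i rows :
  size (kids 0 (row_word i rows)) = size rows /\ has is_leaf (kids 0 (row_word i rows)) = false.
Proof.
elim: rows i => // s rows IH i; rewrite row_word_cons.
have [_ leaf_r _] := children_row i s 0 (low_row i.+1 rows); set r := 1 :: _ in leaf_r *.
have skip_col j : all (ltn 1) (column_word j s).
  elim: s {leaf_r r} j => //= b s IHs j; rewrite all_cat IHs andbT.
  by case: b => //=; rewrite all_nseq orbT.
have -> : kids 0 r = r :: kids 0 (row_word i.+1 rows).
  rewrite [LHS]/= -[2 :: _]/(nseq i.+1 2 ++ _) !kids_skip ?skip_col // all_nseq orbT //.
by have [IH1 IH2] := IH i.+1; rewrite /= IH1 IH2.
Qed.

Lemma children_tree rows :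
  size (children (tree_word rows)) = (size rows).+1 /\ leaf_children (tree_word rows) = 0.
Proof.
have [E1 E2] := kids_rows 0 rows; set R := row_word 0 rows in E1 E2.
have Ec : children (tree_word rows) = (1 :: 2 :: R) :: kids 0 R by [].
rewrite /leaf_children Ec; split; first by rewrite /= E1.
by apply/eqP; rewrite -leqn0 leqNgt -has_count; apply: (negbT E2).
Qed.

(** * Searching for labels and for linked pairs *)

Lemma somewhere_cat (P : pred (seq nat)) v t : somewhere P t -> somewhere P (v ++ t).
Proof. by move=> Pt; elim: v => //= x v ->; rewrite orbT. Qed.

Lemma somewhere_cons P x s : somewhere P (x :: s) = P (x :: s) || somewhere P s.
Proof. by []. Qed.

Lemma somewhere_nseq (P : pred (seq nat)) d k t :
  (forall s, leaf_children s = 0 -> P s = false) -> head 0 t <= d ->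
  somewhere P (nseq k d ++ t) = somewhere P t.
Proof.
move=> P0 low_t; elim: k => //= k ->; rewrite P0 //.
by apply: leaf_children_leaf; exact: (is_leaf_nseq k).
Qed.

Lemma somewhere_rows (P : pred (seq nat)) m i rows :
  (forall s, leaf_children s = 0 -> P s = false) ->
  (forall j t, j < m -> head 0 t <= 2 -> P (2 :: nseq j.+1 3 ++ t) = false) ->
  all (fun s => size s <= m) rows ->
  somewhere P (row_word i rows) =
  has (fun k => P (row_word (i + k) (drop k rows))) (iota 0 (size rows)).
Proof.
move=> P0 Pcol; elim: rows i => // s rows IH i /andP [le_sm /IH{}IH].
have low_t := low_row i.+1 rows.
have scol j : j + size s <= m ->
    somewhere P (column_word j s ++ row_word i.+1 rows) = somewhere P (row_word i.+1 rows).
  elim: s j {le_sm} => // b s IHs j; rewrite /= addnS -addSn => le_jm.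
  have lt_jm : j < m by apply: leq_trans le_jm; rewrite ltnS leq_addr.
  have low2 : head 0 (column_word j.+1 s ++ row_word i.+1 rows) <= 2.
    by apply: low_column; exact: leqW.
  case: b; rewrite ?IHs // -/(column_word j (true :: s)) column_word_true.
  by rewrite somewhere_cons Pcol // somewhere_nseq ?IHs //; exact: leqW.
have low2 : head 0 (column_word 0 s ++ row_word i.+1 rows) <= 2.
  by apply: low_column; exact: leqW.
rewrite [RHS]/= addn0 -[1]addn0 iotaDl has_map.
rewrite [LHS](_ : _ = P (row_word i (s :: rows)) || somewhere P (row_word i.+1 rows)).
  by rewrite IH; congr (_ || _); apply: eq_has => k /=; rewrite addSnnS.
by rewrite row_word_cons somewhere_cons somewhere_nseq // scol.
Qed.

Lemma row_word_drop i k rows : k < size rows ->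
  row_word i (drop k rows) =
  1 :: nseq i.+1 2 ++ column_word 0 (nth [::] rows k) ++ row_word i.+1 (drop k.+1 rows).
Proof. by move=> lt_k; rewrite (drop_nth [::] lt_k). Qed.

Lemma somewhere_tree (P : pred (seq nat)) rows :
  (forall s, leaf_children s = 0 -> P s = false) ->
  P [:: 1, 2 & row_word 0 rows] = false ->
  somewhere P (tree_word rows) = somewhere P (row_word 0 rows).
Proof.
move=> P0 P1; rewrite /= P1 P0; last by have [] := children_tree rows.
rewrite P0 //; apply: leaf_children_leaf; apply: (@is_leaf_nseq 2 0).
by apply: leq_trans (low_row _ _) _.
Qed.

Lemma leaf_children_bound n rows r : 0 < n -> size rows = n ->
  all (fun s => size s == n) rows -> r < size (tree_word rows) ->
  leaf_children (drop r (tree_word rows)) <= n.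
Proof.
move=> n_gt0 size_rows rows_n lt_r; rewrite leqNgt; apply/negP => H.
pose P s := n < leaf_children s.
have P0 s : leaf_children s = 0 -> P s = false by rewrite /P => ->.
have rows_le : all (fun s => size s <= n) rows by apply: sub_all rows_n => s /eqP ->.
have Pcol j t : j < n -> head 0 t <= 2 -> P (2 :: nseq j.+1 3 ++ t) = false.
  by move=> lt_jn low_t; rewrite /P (leaf_children_nseq j.+1 low_t).1 ltnNge lt_jn.
have : somewhere P (tree_word rows) by apply/somewhereP; exists r.
rewrite somewhere_tree //; last first.
  by rewrite /P (leaf_children_nseq 1 (low_row 0 rows)).1 ltnNge n_gt0.
rewrite (somewhere_rows _ P0 Pcol rows_le) => /hasP [k]; rewrite mem_iota add0n => /andP [_ lt_k].
rewrite row_word_drop // /P (_ : leaf_children _ = k.+1) 1?ltnNge -?size_rows ?lt_k //.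
by have [] := children_row k (nth [::] rows k) 0 (low_row k.+1 (drop k.+1 rows)).
Qed.

Definition linked (m n : nat) (s : seq nat) : bool :=
  (leaf_children s == m.+1) && has (fun t => leaf_children t == n.+1) (children s).

(** The parent of such a pair can only be row node [m]: the root and the leaves are unlabelled, and
    all children of a column node or of the extra node are leaves. *)
Lemma somewhere_linked m n c rows : all (fun s => size s <= c) rows ->
  somewhere (linked m n) (tree_word rows) = nth false (nth [::] rows m) n.
Proof.
move=> rows_le.
have P0 s : leaf_children s = 0 -> linked m n s = false by rewrite /linked => ->.
have Pcol j t : j < c -> head 0 t <= 2 -> linked m n (2 :: nseq j.+1 3 ++ t) = false.
  move=> _ low_t; have [_ al] := leaf_children_nseq j.+1 low_t.
  by rewrite /linked has_leaf ?andbF.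
rewrite somewhere_tree //; last first.
  have [_ al] := leaf_children_nseq 1 (low_row 0 rows).
  by rewrite /linked has_leaf ?andbF.
have PE k : k < size rows -> linked m n (row_word (0 + k) (drop k rows)) =
    (k == m) && nth false (nth [::] rows m) n.
  move=> lt_k; rewrite row_word_drop // /linked.
  have [-> _ ->] := children_row k (nth [::] rows k) n (low_row k.+1 (drop k.+1 rows)).
  by rewrite eqSS; case: eqP => // ->.
rewrite (somewhere_rows _ P0 Pcol rows_le).
case: (ltnP m (size rows)) => [lt_m|le_m]; last first.
  rewrite [nth [::] rows m]nth_default // nth_nil; apply/hasP => -[k].
  rewrite mem_iota add0n => /andP [_ lt_k]; rewrite PE // => /andP [/eqP E _].
  by rewrite E ltnNge le_m in lt_k.
apply/hasP/idP => [[k]|H].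
  by rewrite mem_iota add0n => /andP [_ /PE->] /andP [].
by exists m; rewrite ?mem_iota // PE // eqxx.
Qed.

Lemma somewhere_label m rows : m < size rows ->
  somewhere (fun s => leaf_children s == m.+1) (tree_word rows).
Proof.
suff H i : m < size rows -> somewhere (fun s => leaf_children s == (i + m).+1) (row_word i rows).
  by move=> /(H 0); exact: (@somewhere_cat _ [:: 0; 1; 2]).
elim: rows m i => // s rows IH [|m] i lt_m; rewrite row_word_cons.
  have [E _ _] := children_row i s 0 (low_row i.+1 rows).
  by rewrite somewhere_cons E addn0 eqxx.
by rewrite -cat_cons !catA; apply: somewhere_cat; rewrite -addSnnS; exact: IH.
Qed.

Lemma tree_like_tree_word rows : tree_like (tree_word rows).
Proof.
have pos : all (ltn 0) (behead (tree_word rows)).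
  suff H i : all (ltn 0) (row_word i rows) by rewrite /= H.
  have col j s : all (ltn 0) (column_word j s).
    elim: s j => //= b s IH j; rewrite all_cat IH andbT.
    by case: b => //=; rewrite all_nseq orbT.
  by elim: rows i => // s rows IH i; rewrite row_word_cons /= !all_cat col IH all_nseq orbT.
pose e x y := y <= x.+1.
have nseq_path d k : path e d.+1 (nseq k d.+1).
  by elim: k => //= k ->; rewrite /e ltnW ?ltnSn.
have last_pos k d : 0 < last d.+1 (nseq k d.+1) by elim: k => //= k; case: k.
have incr : path e 0 (behead (tree_word rows)).
  have col j s x : 0 < x -> path e x (column_word j s).
    elim: s j x => //= b s IH j x x_gt0; rewrite cat_path.
    case: b => /=; last exact: IH.
    by rewrite nseq_path IH ?last_pos // !andbT.
  suff H i x : path e x (row_word i rows) by rewrite /= H.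
  elim: rows {pos} i x => // s rows IH i x.
  by rewrite row_word_cons /= !cat_path nseq_path IH andbT col.
split=> // [[|c] //= lt_c|c lt_c]; first exact: (all_nthP 0 pos).
exact: (pathP 0 incr).
Qed.

(** * A machine that computes the reduction *)

Definition depth : Type := 'I_4.

(* [inl b] is to be written on the output tape; [inr d] is to be appended to the
   depth word, together with a bit [true] of the header on the output tape. *)
Definition emission : Type := (bool + depth)%type.

(* The option marks the node whose row is being written ([Some true]) and its
   parent ([Some false]). *)
Definition symbol : Type := (depth * option bool)%type.

Definition bit (b : bool) : cell symbol := Some (inl b).
Definition plain (d : depth) : cell symbol := Some (inr (d, None)).
Definition here (d : depth) : cell symbol := Some (inr (d, Some true)).
Definition parent (d : depth) : cell symbol := Some (inr (d, Some false)).

(* [None] for a quantified variable; [Some (e, b)] for a variable of an atom,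
   where [e] tells [Edge] from [Equal] and [b] the second argument from the
   first one. *)
Definition variable_role : Type := option (bool * bool).

(* The machine has an input tape, unary counters I and J for the current row and
   column (a block of [false]s followed by a block of [true]s, whose length is
   the value), a tape W for the depth word, and an output tape O. *)
Inductive control :=
| Load | RowNext | SweepI | ColNext | SweepJ | ResetJ
| WRewind | Here | Back | Tok0 | Tok1 | Tok2 | Tok3 | Tok4 | Tok5
| ORewind | Halt
| FindParent of depth | ToLeft of depth | Sweep of depth | Child of depth
| Var of variable_role | VarBits of variable_role | VarBit of variable_role.

Definition control_code (q : control) :
    ('I_17 + 'I_4 * depth + 'I_3 * variable_role)%type :=
  match q with
  | Load => inl (inl (inord 0))
  | RowNext => inl (inl (inord 1))
  | SweepI => inl (inl (inord 2))
  | ColNext => inl (inl (inord 3))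
  | SweepJ => inl (inl (inord 4))
  | ResetJ => inl (inl (inord 5))
  | WRewind => inl (inl (inord 6))
  | Here => inl (inl (inord 7))
  | Back => inl (inl (inord 8))
  | Tok0 => inl (inl (inord 9))
  | Tok1 => inl (inl (inord 10))
  | Tok2 => inl (inl (inord 11))
  | Tok3 => inl (inl (inord 12))
  | Tok4 => inl (inl (inord 13))
  | Tok5 => inl (inl (inord 14))
  | ORewind => inl (inl (inord 15))
  | Halt => inl (inl (inord 16))
  | FindParent d => inl (inr (inord 0, d))
  | ToLeft d => inl (inr (inord 1, d))
  | Sweep d => inl (inr (inord 2, d))
  | Child d => inl (inr (inord 3, d))
  | Var r => inr (inord 0, r)
  | VarBits r => inr (inord 1, r)
  | VarBit r => inr (inord 2, r)
  end.

Definition control_decode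
    (c : ('I_17 + 'I_4 * depth + 'I_3 * variable_role)%type) : control :=
  match c with
  | inl (inl k) =>
      nth Load [:: Load; RowNext; SweepI; ColNext; SweepJ; ResetJ; WRewind;
        Here; Back; Tok0; Tok1; Tok2; Tok3; Tok4; Tok5; ORewind; Halt] k
  | inl (inr (k, d)) =>
      nth Load [:: FindParent d; ToLeft d; Sweep d; Child d] k
  | inr (k, r) => nth Load [:: Var r; VarBits r; VarBit r] k
  end.

Lemma control_codeK : cancel control_code control_decode.
Proof. by case=> [|||||||||||||||||?|?|?|?|?|?|?] /=; rewrite inordK. Qed.

HB.instance Definition _ := Finite.copy control (can_type control_codeK).

Definition encode_word (s : seq token) : seq bool :=
  flatten [seq encode_token k | k <- s].

(** Apart from its two renamed variables, a translated atom is constant; it consists of three fixed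
    blocks around them. They are locked so that simplification does not expand them. *)
Definition opening : seq bool :=
  locked (encode_word [:: KExists; KVar 0; KNot; KOr; KNot; KEqual; KVar 0]).
Definition middle : seq bool :=
  locked (encode_word
    [:: KNot; KExists; KVar 2; KNot; KOr; KNot; KEqual; KVar 2]).
Definition closing (is_edge : bool) : seq bool :=
  locked (encode_word (KNot :: word (core is_edge))).


Definition emit_bits (s : seq bool) : seq emission := [seq inl b | b <- s].
Definition emit_depths (s : seq nat) : seq emission := [seq inr (inord d) | d <- s].

Arguments emit_bits : simpl never.
Arguments emit_depths : simpl never.

Definition after_variable (r : variable_role) : control * seq bool :=
  match r with
  | None => (Tok0, [::])
  | Some (is_edge, false) => (Var (Some (is_edge, true)), middle)
  | Some (is_edge, true) => (Tok0, closing is_edge)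
  end.

Definition action : Type := (option (cell symbol) * direction)%type.

Definition stay : action := (None, Stay).
Definition left_ : action := (None, GoLeft).
Definition right_ : action := (None, GoRight).
Definition put (c : cell symbol) (d : direction) : action := (Some c, d).

Definition response : Type :=
  (control * seq emission * bool * action * action * action * action)%type.

(** The response lists the next state, the pending emissions, whether the input head advances, and
    the actions on I, J, W and O. A counter is increased by turning its last [false] into [true]. A
    row of the tree matrix takes a walk to the left that marks the parent, a sweep to the right that
    emits the entries, and a walk back to the current node. *)
Definition delta (q : control) (x i j w o : cell symbol) : response :=
  match q with
  | Load =>
    if x is Some (inl true) then
      (Load, [::], true, put (bit false) GoRight, put (bit false) GoRight, stay, stay)
    else (RowNext, emit_depths [:: 0; 1; 2], true, left_, left_, stay, stay)
  | RowNext =>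
    match i with
    | Some (inl true) => (RowNext, [::], false, left_, stay, stay, stay)
    | Some _ => (SweepI, emit_depths [:: 1], false, put (bit true) Stay, stay, stay, stay)
    | None => (WRewind, emit_bits [:: false], false, stay, stay, left_, stay)
    end
  | SweepI =>
    if i is Some _ then (SweepI, emit_depths [:: 2], false, right_, stay, stay, stay)
    else (ColNext, [::], false, left_, stay, stay, stay)
  | ColNext =>
    match j with
    | Some (inl true) => (ColNext, [::], false, stay, left_, stay, stay)
    | Some _ =>
      if x is Some (inl true) then
        (SweepJ, emit_depths [:: 2], true, stay, put (bit true) Stay, stay, stay)
      else (ColNext, [::], true, stay, put (bit true) Stay, stay, stay)
    | None => (ResetJ, [::], false, stay, right_, stay, stay)
    end
  | SweepJ =>
    if j is Some _ then (SweepJ, emit_depths [:: 3], false, stay, right_, stay, stay)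
    else (ColNext, [::], false, stay, left_, stay, stay)
  | ResetJ =>
    if j is Some _ then
      (ResetJ, [::], false, stay, put (bit false) GoRight, stay, stay)
    else (RowNext, [::], false, stay, left_, stay, stay)
  | WRewind =>
    if w is Some _ then (WRewind, [::], false, stay, stay, left_, stay)
    else (Here, [::], false, stay, stay, right_, stay)
  | Here =>
    if w is Some (inr (d, _)) then
      (FindParent d, [::], false, stay, stay, put (here d) GoLeft, stay)
    else (Tok0, [::], false, stay, stay, stay, stay)
  | FindParent d =>
    if w is Some (inr (d', _)) then
      if d' < d then (ToLeft d, [::], false, stay, stay, put (parent d') GoLeft, stay)
      else (FindParent d, [::], false, stay, stay, left_, stay)
    else (Sweep d, [::], false, stay, stay, right_, stay)
  | ToLeft d =>
    if w is Some _ then (ToLeft d, [::], false, stay, stay, left_, stay)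
    else (Sweep d, [::], false, stay, stay, right_, stay)
  | Sweep d =>
    match w with
    | Some (inr (d', Some false)) =>
        (Sweep d, emit_bits [:: d'.+1 == d], false, stay, stay, put (plain d') GoRight, stay)
    | Some (inr (_, Some true)) =>
        (Child d, emit_bits [:: false], false, stay, stay, right_, stay)
    | Some _ => (Sweep d, emit_bits [:: false], false, stay, stay, right_, stay)
    | None => (Back, [::], false, stay, stay, left_, stay)
    end
  | Child d =>
    if w is Some (inr (d', _)) then
      if d' <= d then (Sweep d, emit_bits [:: false], false, stay, stay, right_, stay)
      else (Child d, emit_bits [:: val d' == d.+1], false, stay, stay, right_, stay)
    else (Back, [::], false, stay, stay, left_, stay)
  | Back =>
    if w is Some (inr (d, Some true)) then
      (Here, [::], false, stay, stay, put (plain d) GoRight, stay)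
    else (Back, [::], false, stay, stay, left_, stay)
  | Tok0 =>
    if x is Some _ then (Tok1, [::], true, stay, stay, stay, stay)
    else (ORewind, [::], false, stay, stay, stay, left_)
  | Tok1 =>
    if x is Some (inl true) then (Tok2, [::], true, stay, stay, stay, stay)
    else (Var (Some (false, false)), emit_bits opening, true, stay, stay, stay, stay)
  | Tok2 =>
    if x is Some (inl true) then (Tok3, [::], true, stay, stay, stay, stay)
    else (Var (Some (true, false)), emit_bits opening, true, stay, stay, stay, stay)
  | Tok3 =>
    if x is Some (inl true) then (Tok4, [::], true, stay, stay, stay, stay)
    else (Tok0, emit_bits (encode_token KNot), true, stay, stay, stay, stay)
  | Tok4 =>
    if x is Some (inl true) then (Tok5, [::], true, stay, stay, stay, stay)
    else (Tok0, emit_bits (encode_token KOr), true, stay, stay, stay, stay)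
  | Tok5 => (Var None, emit_bits (encode_token KExists), true, stay, stay, stay, stay)
  | Var r =>
    (VarBits r, emit_bits [:: false; true; true], true, stay, stay, stay, stay)
  | VarBits r =>
    if x is Some (inl true) then (VarBit r, [::], true, stay, stay, stay, stay)
    else ((after_variable r).1, emit_bits (false :: (after_variable r).2),
          true, stay, stay, stay, stay)
  | VarBit r =>
    let b := if x is Some (inl true) then true else false in
    (VarBits r, emit_bits [:: true; b], true, stay, stay, stay, stay)
  | ORewind =>
    if o is Some _ then (ORewind, [::], false, stay, stay, stay, left_)
    else (Halt, [::], false, stay, stay, stay, right_)
  | Halt => (Halt, [::], false, stay, stay, stay, stay)
  end.

(** * An abstract machine and its simulation *)

Definition push (T : Type) (c : option T) (s : seq (option T)) : seq (option T) :=
  if c is Some _ then c :: s else if s is [::] then [::] else c :: s.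

(* Tapes are compared up to trailing blanks. *)
Definition strip (T : Type) (s : seq (option T)) : seq (option T) :=
  foldr (@push T) [::] s.

Definition move_tape (a : action) (t : tape symbol) : tape symbol :=
  match a with
  | (None, Stay) => t
  | (None, GoLeft) => (behead t.1, push (head None t.1) t.2)
  | (None, GoRight) => (push (head None t.2) t.1, behead t.2)
  | (Some c, Stay) => (t.1, c :: behead t.2)
  | (Some c, GoLeft) => (behead t.1, push (head None t.1) (c :: behead t.2))
  | (Some c, GoRight) => (push c t.1, behead t.2)
  end.
Arguments move_tape a t /.

Definition emit_W (e : emission) (w : tape symbol) : tape symbol :=
  if e is inr d then move_tape (put (plain d) GoRight) w else w.

Definition emit_O (e : emission) (o : tape symbol) : tape symbol :=
  move_tape (put (bit (if e is inl b then b else true)) GoRight) o.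

(* The queue of pending emissions is flushed before the control moves on.  The
   left part of the input tape is omitted, as its head never turns back. *)
Inductive sconfig :=
  Conf of control & seq emission & seq (cell symbol) &
    tape symbol & tape symbol & tape symbol & tape symbol.

Definition sstep (c : sconfig) : sconfig :=
  let: Conf q s x i j w o := c in
  if s is e :: s' then Conf q s' x i j (emit_W e w) (emit_O e o)
  else
    let: (q', s', adv, ai, aj, aw, ao) :=
      delta q (head None x) (tape_read i) (tape_read j) (tape_read w) (tape_read o) in
    Conf q' s' (if adv then behead x else x)
      (move_tape ai i) (move_tape aj j) (move_tape aw w) (move_tape ao o).

(** The 6 covers the longest of the short emissions, the code of [KExists]. The number also serves
    as the expansion factor for encoded formulas. *)
Definition queue_bound : nat :=
  6 + size opening + size middle + size (closing true) + size (closing false).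

(** This keeps [insub_bseq] in [transition_of] from falling back to its default, so no emission is
    lost. *)
Lemma delta_queue q x i j w o :
  size (delta q x i j w o).1.1.1.1.1.2 <= queue_bound.
Proof.
have emitE (s : seq bool) : size (emit_bits s) = size s by rewrite size_map.
have small n : n <= 6 -> n <= queue_bound.
  by rewrite /queue_bound -!addnA => /leq_trans-> //; exact: leq_addr.
have bounds a b c d : let m := 6 + a + b + c + d in
  [/\ a <= m, b < m, c < m & d < m] by split; lia.
have [] := bounds (size opening) (size middle) (size (closing true))
  (size (closing false)); rewrite -/queue_bound => bo bm bt bf.
have ba r : size (after_variable r).2 < queue_bound.
  by case: r => [[[] []]|] //; exact: small.
move: queue_bound small bo ba {bounds bm bt bf} => m small bo ba.
case: q => [|||||||||||||||||d|d|d|d|r|r|r] /=;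
  repeat match goal with
  | |- context [match ?t with _ => _ end] => is_var t; case: t => * /=
  | |- context [if ?t then _ else _] => case: t => /=
  end; rewrite ?emitE ?size_map; auto.
Qed.

Definition machine_state : Type := (control * queue_bound.-bseq emission)%type.

Definition tape_no (k : nat) : 'I_5 := inord k.

Definition act (c : cell symbol) (a : action) : cell symbol * direction :=
  (odflt c a.1, a.2).

Definition transition_of (st : machine_state)
    (rd : {ffun 'I_5 -> cell symbol}) :
    machine_state * {ffun 'I_5 -> cell symbol * direction} :=
  let acts (al : seq action) : {ffun 'I_5 -> cell symbol * direction} :=
    [ffun k => act (rd k) (nth stay al (val k))] in
  if val st.2 is e :: s then
    ((st.1, insub_bseq _ s), acts [:: stay; stay; stay;
        (if e is inr d then put (plain d) GoRight else stay);
        put (bit (if e is inl b then b else true)) GoRight])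
  else
    let: (q', s', adv, ai, aj, aw, ao) :=
      delta st.1 (rd (tape_no 0)) (rd (tape_no 1)) (rd (tape_no 2))
        (rd (tape_no 3)) (rd (tape_no 4)) in
    ((q', insub_bseq _ s'), acts [:: if adv then right_ else stay; ai; aj; aw; ao]).

Definition halting_of (st : machine_state) : bool :=
  (st.1 == Halt) && nilp (val st.2).

Definition transducer : machine :=
  @Machine _ _ 4 (Load, insub_bseq _ [::]) halting_of transition_of.

Definition tape_sim (t t' : tape symbol) : Prop :=
  strip t.1 = strip t'.1 /\ strip t.2 = strip t'.2.

Definition sim (c : config transducer) (a : sconfig) : Prop :=
  let: Conf q s x i j w o := a in
  [/\ c.1.1 = q, val c.1.2 = s, strip (c.2 (tape_no 0)).2 = strip x &
    [/\ tape_sim (c.2 (tape_no 1)) i, tape_sim (c.2 (tape_no 2)) j,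
       tape_sim (c.2 (tape_no 3)) w & tape_sim (c.2 (tape_no 4)) o]].

Lemma head_strip T (s : seq (option T)) : head None (strip s) = head None s.
Proof. by case: s => [|[c|] s] //=; case: (strip s). Qed.

Lemma behead_strip T (s : seq (option T)) : behead (strip s) = strip (behead s).
Proof. by case: s => [|[c|] s] //=; case: (strip s). Qed.

Lemma strip_push T (c : option T) s : strip (push c s) = push c (strip s).
Proof. by case: c => [c|] //=; case: s. Qed.

Lemma head_sim T (s s' : seq (option T)) :
  strip s = strip s' -> head None s = head None s'.
Proof. by move=> E; rewrite -head_strip E head_strip. Qed.

Lemma behead_sim T (s s' : seq (option T)) :
  strip s = strip s' -> strip (behead s) = strip (behead s').
Proof. by move=> E; rewrite -!behead_strip E. Qed.

Lemma read_sim t t' : tape_sim t t' -> tape_read t = tape_read t'.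
Proof. by case=> _ /head_sim. Qed.

Lemma strip_eta T (s : seq (option T)) :
  push (head None s) (strip (behead s)) = strip s.
Proof. by case: s. Qed.

Lemma move_sim t t' a : tape_sim t t' ->
  tape_sim (tape_move (tape_write t (act (tape_read t) a).1)
             (act (tape_read t) a).2) (move_tape a t').
Proof.
case: t t' a => [l r] [l' r'] [c d] [/= El Er].
have Er2 := behead_sim Er; have El2 := behead_sim El.
have Hr := head_sim Er; have Hl := head_sim El.
rewrite /tape_sim /tape_read.
by case: c => [c|]; case: d => /=;
  rewrite ?strip_push ?El ?Er2 ?El2 ?Hl ?Hr ?strip_eta -?Er ?strip_eta.
Qed.

Lemma sim_step c a : sim c a -> sim (step c) (sstep a).
Proof.
case: c a => [[q s] t] [q' s' x i j w o] [/= <- <- Ex [Si Sj Sw So]].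
have tn k : k < 5 -> tape_no k = k :> nat by move=> ?; rewrite /tape_no inordK.
have hx : tape_read (t (tape_no 0)) = head None x := head_sim Ex.
rewrite /step /= /halting_of /=.
(* In [Halt] with an empty queue the machine stops, and [sstep] idles as well. *)
case: ifP => [/andP [/eqP -> /nilP /= Es]|_].
  by rewrite Es /=.
rewrite /transition_of /=.
case Es: (bseqval s) => [|e s1] /=.
  have := delta_queue q (head None x) (tape_read i) (tape_read j) (tape_read w) (tape_read o).
  rewrite !ffunE (read_sim Si) (read_sim Sj) (read_sim Sw) (read_sim So).
  rewrite hx.
  case: (delta _ _ _ _ _ _) => [[[[[[q1 s1] adv] ai] aj] aw] ao] /= le_s1.
  split=> //.
  - by rewrite /insub_bseq /insubd insubT.
  - rewrite !ffunE tn //=; case: adv => //=; last by rewrite strip_eta.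
    exact: behead_sim.
  split; rewrite !ffunE tn //=; exact: move_sim.
have le_s1 : size s1 <= queue_bound by apply: leq_trans (size_bseq s); rewrite Es /=.
split=> //.
- by rewrite /insub_bseq /insubd insubT.
- by rewrite !ffunE tn //= strip_eta.
split; rewrite !ffunE tn //=.
- exact: (move_sim stay).
- exact: (move_sim stay).
- case: e {Es} => [b|d] /=; first exact: (move_sim stay).
  by have := move_sim (put (plain d) GoRight) Sw; exact.
- by have := move_sim (put (bit (if e is inl b then b else true)) GoRight) So; exact.
Qed.

(** * First phase: writing the depth word *)

Definition reach (n : nat) (a b : sconfig) : Prop :=
  exists2 m, m <= n & iter m sstep a = b.

Lemma reach_refl n a : reach n a a.
Proof. by exists 0. Qed.

Lemma reach_trans n m a b c : reach n a b -> reach m b c -> reach (n + m) a c.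
Proof.
move=> [n' le_n <-] [m' le_m <-]; exists (m' + n'); last by rewrite iterD.
by rewrite addnC leq_add.
Qed.

Lemma reach_le n m a b : n <= m -> reach n a b -> reach m a b.
Proof. by move=> le_nm [k /leq_trans-/(_ _ le_nm) le_km <-]; exists k. Qed.

Lemma reach_step n a b : reach n (sstep a) b -> reach n.+1 a b.
Proof. by move=> [m le_m <-]; exists m.+1; rewrite ?iterSr. Qed.

Definition bits (s : seq bool) : seq (cell symbol) := [seq bit b | b <- s].
Definition plains (u : seq nat) : seq (cell symbol) := [seq plain (inord d) | d <- u].

Definition out_tape (v : seq bool) : tape symbol := (bits (rev v), [::]).
Definition word_tape (u : seq nat) : tape symbol := (plains (rev u), [::]).

Lemma bits_cat s t : bits (s ++ t) = bits s ++ bits t.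
Proof. exact: map_cat. Qed.

Lemma nseq_shift T k (x : T) l : nseq k x ++ x :: l = x :: nseq k x ++ l.
Proof. by elim: k => //= k ->. Qed.

Lemma bits_nseq k b : bits (nseq k b) = nseq k (bit b).
Proof. exact: map_nseq. Qed.

Lemma reach_emit_bits q s x i j w v :
  reach (size s) (Conf q (emit_bits s) x i j w (out_tape v))
    (Conf q [::] x i j w (out_tape (v ++ s))).
Proof.
elim: s v => [|b s IH] v; first by rewrite cats0; exact: reach_refl.
apply: reach_step; rewrite -cat_rcons /=.
by move: (IH (rcons v b)); rewrite {1}/out_tape rev_rcons.
Qed.

(** In this phase the output tape holds one [true] per node, so the unary header grows together with
    the word. *)
Definition BConf q s x i j u : sconfig :=
  Conf q s x i j (word_tape u) (out_tape (nseq (size u) true)).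

Lemma reach_emit_depths q s x i j u :
  reach (size s) (BConf q (emit_depths s) x i j u)
    (BConf q [::] x i j (u ++ s)).
Proof.
elim: s u => [|d s IH] u; first by rewrite cats0; exact: reach_refl.
apply: reach_step; rewrite -cat_rcons /=.
move: (IH (rcons u d)).
rewrite {1}/BConf {1}/out_tape {1}/word_tape rev_rcons size_rcons.
by rewrite -(addn1 (size u)) nseqD rev_cat.
Qed.

Lemma reach_emit_depth n c q d x i j u :
  reach n (BConf q [::] x i j (rcons u d)) c ->
  reach n.+1 (BConf q (emit_depths [:: d]) x i j u) c.
Proof.
by move=> H; apply: (reach_trans (reach_emit_depths q [:: d] _ _ _ _)); rewrite cats1.
Qed.

Lemma reach_load k m x w o :
  let t n : tape symbol := (bits (nseq n false), [::]) in
  reach k (Conf Load [::] (bits (nseq k true) ++ x) (t m) (t m) w o)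
    (Conf Load [::] x (t (k + m)) (t (k + m)) w o).
Proof.
move=> t; elim: k m => [|k IH] m; first exact: reach_refl.
by apply: reach_step; rewrite addSnnS; exact: IH m.+1.
Qed.

(** Value [i] with room for [m] more, the head on the last cell. The left half of a tape is listed
    from the head outwards, so the [true]s come first. *)
Definition counter (i m : nat) : tape symbol :=
  move_tape left_ (bits (nseq i true) ++ bits (nseq m false), [::]).

(** Same contents, with the head on the cell that the next increment changes, or on the blank before
    the block if [m] is 0. *)
Definition rewound (i m : nat) : tape symbol :=
  move_tape left_ (bits (nseq m false), bits (nseq i true)).

Lemma reach_rewind_I k l r x j w o :
  reach k
    (Conf RowNext [::] x (move_tape left_ (bits (nseq k true) ++ l, r)) j w o)
    (Conf RowNext [::] x (move_tape left_ (l, bits (nseq k true) ++ r)) j w o).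
Proof.
elim: k r => [|k IH] r; first exact: reach_refl.
apply: reach_step; rewrite /=.
by have := IH (bit true :: r); rewrite !bits_nseq nseq_shift.
Qed.

Lemma reach_rewind_J k l r x i w o :
  reach k
    (Conf ColNext [::] x i (move_tape left_ (bits (nseq k true) ++ l, r)) w o)
    (Conf ColNext [::] x i (move_tape left_ (l, bits (nseq k true) ++ r)) w o).
Proof.
elim: k r => [|k IH] r; first exact: reach_refl.
apply: reach_step; rewrite /=.
by have := IH (bit true :: r); rewrite !bits_nseq nseq_shift.
Qed.

Lemma reach_counter_I k m x j w o :
  reach k (Conf RowNext [::] x (counter k m) j w o) (Conf RowNext [::] x (rewound k m) j w o).
Proof. by have := reach_rewind_I k (bits (nseq m false)) [::]; rewrite cats0; exact. Qed.

Lemma reach_sweep_I k l x j u :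
  reach (k.*2.+1) (BConf SweepI [::] x (l, bits (nseq k true)) j u)
    (BConf ColNext [::] x (move_tape left_ (bits (nseq k true) ++ l, [::])) j
       (u ++ nseq k 2)).
Proof.
elim: k l u => [|k IH] l u.
  by rewrite cats0; apply: reach_step; exact: reach_refl.
rewrite doubleS; apply: reach_step; rewrite /=.
apply: reach_emit_depth; rewrite -cat_rcons.
by have := IH (bit true :: l) (rcons u 2); rewrite !bits_nseq nseq_shift.
Qed.

Lemma reach_counter_J k m x i w o :
  reach k (Conf ColNext [::] x i (counter k m) w o) (Conf ColNext [::] x i (rewound k m) w o).
Proof. by have := reach_rewind_J k (bits (nseq m false)) [::]; rewrite cats0; exact. Qed.

Lemma reach_sweep_J k l x i u :
  reach (k.*2.+1) (BConf SweepJ [::] x i (l, bits (nseq k true)) u)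
    (BConf ColNext [::] x i (move_tape left_ (bits (nseq k true) ++ l, [::]))
       (u ++ nseq k 3)).
Proof.
elim: k l u => [|k IH] l u.
  by rewrite cats0; apply: reach_step; exact: reach_refl.
rewrite doubleS; apply: reach_step; rewrite /=.
apply: reach_emit_depth; rewrite -cat_rcons.
by have := IH (bit true :: l) (rcons u 3); rewrite !bits_nseq nseq_shift.
Qed.

Lemma reach_reset_J k m x i w o :
  reach k.+1
    (Conf ResetJ [::] x i (bits (nseq m false), bits (nseq k true)) w o)
    (Conf RowNext [::] x i (counter 0 (k + m)) w o).
Proof.
elim: k m => [|k IH] m; first by apply: reach_step; exact: reach_refl.
by apply: reach_step; rewrite addSnnS; exact: IH m.+1.
Qed.

Lemma rewoundS i m :
  rewound i m.+1 = (bits (nseq m false), bit false :: bits (nseq i true)).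
Proof. by []. Qed.

Lemma reach_column b j m x i u :
  reach (3 * j + 6)
    (BConf ColNext [::] (bit b :: x) i (rewound j m.+1) u)
    (BConf ColNext [::] x i (rewound j.+1 m)
      (u ++ if b then 2 :: nseq j.+1 3 else [::])).
Proof.
rewrite rewoundS; case: b; last first.
  rewrite cats0; apply: (@reach_le 2); first by lia.
  by apply: reach_step; rewrite /=; apply: reach_step; exact: reach_refl.
(* Reading the bit and emitting depth 2, a sweep with two steps per cell, and the way back to the
   next free cell. *)
apply: (@reach_le (2 + (j.+1.*2.+1 + j.+1))); first by lia.
apply: reach_step; rewrite /=; apply: reach_emit_depth; rewrite -cat_rcons.
exact: (reach_trans (reach_sweep_J j.+1 _ _ _ _) (reach_counter_J _ _ _ _ _ _)).
Qed.

Lemma reach_columns s j x i u :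
  reach (size s * (3 * (j + size s) + 6))
    (BConf ColNext [::] (bits s ++ x) i (rewound j (size s)) u)
    (BConf ColNext [::] x i (rewound (j + size s) 0) (u ++ column_word j s)).
Proof.
elim: s j u => [|b s IH] j u; first by rewrite addn0 cats0; exact: reach_refl.
have := reach_trans (reach_column b j (size s) (bits s ++ x) i u) (IH j.+1 _).
rewrite -catA addSnnS; apply: reach_le; rewrite /= ; nia.
Qed.

Lemma reach_row s i m x u : 0 < size s ->
  let t := counter 0 (size s) in
  reach (3 * i + 7 + size s * (3 * size s + 8))
    (BConf RowNext [::] (bits s ++ x) (counter i m.+1) t u)
    (BConf RowNext [::] x (counter i.+1 m) t (u ++ (1 :: nseq i.+1 2) ++ column_word 0 s)).
Proof.
move=> s_gt0 t.
apply: (@reach_le (i + (2 + (i.+1.*2.+1 +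
  (size s * (3 * (0 + size s) + 6) + (size s).+2))))); first by nia.
(* The final word is abstracted so that simplifying the run leaves it alone. *)
have [u' Eu'] : {u' | u' = u ++ [:: 1] ++ nseq i.+1 2 ++ column_word 0 s} by eexists.
rewrite -Eu'; apply: (reach_trans (reach_counter_I _ _ _ _ _ _)); rewrite rewoundS.
apply: reach_step; rewrite /=; apply: reach_emit_depth; rewrite {}Eu' [u ++ _]catA cats1 catA.
apply: (reach_trans (reach_sweep_I i.+1 _ _ _ _)).
apply: (reach_trans (reach_columns s 0 x _ _)); rewrite add0n.
case: (size s) s_gt0 @t => // n _ t.
apply: reach_step; rewrite /rewound /=.
by have := reach_reset_J n.+1 0 x (counter i.+1 m); rewrite addn0; apply.
Qed.

Lemma reach_rows n rows i x u : 0 < n -> all (fun s => size s == n) rows ->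
  reach (size rows * (3 * (i + size rows) + 7 + n * (3 * n + 8)))
    (BConf RowNext [::] (bits (flatten rows) ++ x) (counter i (size rows)) (counter 0 n) u)
    (BConf RowNext [::] x (counter (i + size rows) 0) (counter 0 n) (u ++ row_word i rows)).
Proof.
move=> n_gt0; elim: rows i u => [|s rows IH] i u /=.
  by rewrite addn0 cats0 => _; exact: reach_refl.
move=> /andP [/eqP En /IH{}IH].
have := reach_row i (size rows) (bits (flatten rows) ++ x) u.
move=> /(_ s); rewrite En => /(_ n_gt0) /reach_trans-/(_ _ _ (IH i.+1 _)).
rewrite addSnnS bits_cat -!catA; apply: reach_le; nia.
Qed.

(** * Second phase: the adjacency matrix of the tree *)

Lemma reach_W_rewind l r x i j o :
  reach (size l).+1
    (Conf WRewind [::] x i j (move_tape left_ (plains l, r)) o)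
    (Conf Here [::] x i j ([::], catrev (plains l) r) o).
Proof.
elim: l r => [|d l IH] r.
  by apply: reach_step; case: r => [|c r]; exact: reach_refl.
apply: reach_step; exact: (IH (plain (inord d) :: r)).
Qed.

(* [true] tags the cell that carries the [parent] mark. *)
Fixpoint mark_parent (d : nat) (u : seq nat) : seq (nat * bool) :=
  if u is x :: u' then
    if x < d then (x, true) :: [seq (y, false) | y <- u']
    else (x, false) :: mark_parent d u'
  else [::].

Definition marked_cells (s : seq (nat * bool)) : seq (cell symbol) :=
  [seq if p.2 then parent (inord p.1) else plain (inord p.1) | p <- s].

Definition marked_bits (d : nat) (s : seq (nat * bool)) : seq bool :=
  [seq p.2 && (p.1.+1 == d) | p <- s].

Lemma marked_bits_plain d u : marked_bits d [seq (y, false) | y <- u] = nseq (size u) false.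
Proof. by elim: u => //= x u ->. Qed.

Lemma marked_cells_plain u : marked_cells [seq (y, false) | y <- u] = plains u.
Proof. by rewrite /marked_cells -map_comp. Qed.

Lemma left_bits_mark d u : left_bits d u = marked_bits d (mark_parent d u).
Proof.
elim: u => //= x u IH; case: ifP => _ /=; last by rewrite IH.
by rewrite marked_bits_plain.
Qed.

Lemma mark_parent_fst d u : [seq p.1 | p <- mark_parent d u] = u.
Proof.
elim: u => //= x u IH; case: ifP => _ /=; last by rewrite IH.
by rewrite -map_comp map_id.
Qed.

Definition depths (u : seq nat) : bool := all (fun d => d < 4) u.

Lemma reach_to_left (d : depth) u c r x i j o :
  reach (size u).+1
    (Conf (ToLeft d) [::] x i j (move_tape left_ (plains u, c :: r)) o)
    (Conf (Sweep d) [::] x i j ([::], catrev (plains u) (c :: r)) o).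
Proof.
elim: u c r => [|y u IH] c r; first by apply: reach_step; exact: reach_refl.
by apply: reach_step; exact: IH (plain (inord y)) (c :: r).
Qed.

Lemma reach_find_parent (d : depth) u c r x i j o : depths u ->
  reach (size u).+1
    (Conf (FindParent d) [::] x i j (move_tape left_ (plains u, c :: r)) o)
    (Conf (Sweep d) [::] x i j ([::], catrev (marked_cells (mark_parent d u)) (c :: r)) o).
Proof.
elim: u c r => [|y u IH] c r; first by move=> _; apply: reach_step; exact: reach_refl.
move=> /= /andP [y_lt4 /IH{}IH]; apply: reach_step; rewrite /= inordK //.
case: ifP => _; last exact: IH (plain (inord y)) (c :: r).
rewrite /= marked_cells_plain; exact: reach_to_left u (parent (inord y)) (c :: r) _ _ _ _.
Qed.

Lemma reach_sweep (d : depth) s l r x i j v : depths [seq p.1 | p <- s] ->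
  reach (size s).*2
    (Conf (Sweep d) [::] x i j (l, marked_cells s ++ r) (out_tape v))
    (Conf (Sweep d) [::] x i j (catrev (plains [seq p.1 | p <- s]) l, r)
      (out_tape (v ++ marked_bits d s))).
Proof.
elim: s l v => [|[y b] s IH] l v /=; first by rewrite cats0 => _; exact: reach_refl.
move=> /andP [y_lt4 /IH{}IH]; rewrite doubleS; apply: reach_step; rewrite -cat_rcons /=.
case: b => /=.
  rewrite inordK //.
  apply: (reach_trans (reach_emit_bits _ [:: _] _ _ _ _ _)); rewrite cats1; exact: IH.
apply: (reach_trans (reach_emit_bits _ [:: _] _ _ _ _ _)); rewrite cats1; exact: IH.
Qed.

Lemma size_mark_parent d u : size (mark_parent d u) = size u.
Proof. by rewrite -{2}(mark_parent_fst d u) size_map. Qed.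

Lemma reach_child (d : depth) v l x i j o : depths v ->
  reach (size v).*2.+1
    (Conf (Child d) [::] x i j (l, plains v) (out_tape o))
    (Conf Back [::] x i j (move_tape left_ (catrev (plains v) l, [::]))
      (out_tape (o ++ right_bits d v))).
Proof.
elim: v l o => [|y v IH] l o /=.
  by rewrite cats0 => _; apply: reach_step; exact: reach_refl.
move=> /andP [y_lt4 dv]; rewrite doubleS; apply: reach_step; rewrite /= inordK //.
case: ifP => _ /=; apply: (reach_trans (reach_emit_bits _ [:: _] _ _ _ _ _)).
  (* Past the subtree the machine returns to [Sweep]; the remaining cells carry no mark and yield
     only [false]. *)
  rewrite cats1 -cat_rcons -(addn1 _.*2).
  have := reach_sweep d (s := [seq (z, false) | z <- v]) (plain (inord y) :: l) [::] x i j
    (rcons o false).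
  rewrite marked_cells_plain marked_bits_plain -map_comp map_id size_map cats0.
  move=> /(_ dv) /reach_trans; apply.
  by apply: reach_step; exact: reach_refl.
rewrite cats1 -cat_rcons; exact: IH.
Qed.

Lemma reach_back v (d : depth) l r x i j o :
  reach (size v).+1
    (Conf Back [::] x i j (move_tape left_ (plains v ++ here d :: l, r)) o)
    (Conf Here [::] x i j (plain d :: l, catrev (plains v) r) o).
Proof.
elim: v r => [|y v IH] r; first by apply: reach_step; exact: reach_refl.
by apply: reach_step; exact: IH (plain (inord y) :: r).
Qed.

Lemma plains_rev u : plains (rev u) = rev (plains u).
Proof. exact: map_rev. Qed.

Lemma reach_matrix_row u d v x i j o : depths (u ++ d :: v) ->
  reach (3 * size (u ++ v) + 6)
    (Conf Here [::] x i j (plains (rev u), plains (d :: v)) (out_tape o))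
    (Conf Here [::] x i j (plains (rev (rcons u d)), plains v)
      (out_tape (o ++ matrix_row u d v))).
Proof.
rewrite /depths all_cat /= => /and3P [du d_lt4 dv].
have du' : depths (rev u) by rewrite /depths all_rev.
have Ed : val (inord d : depth) = d by rewrite /= inordK.
(* Marking the node, the way to the left end, the sweep over [u], the diagonal entry, the entries of
   [v], and the way back. *)
apply: (@reach_le (1 + (size (rev u)).+1 + ((size (rev u)).*2 +
  (2 + ((size v).*2.+1 + (size v).+1))))); first by rewrite size_cat size_rev; lia.
rewrite -addnA; apply: reach_step.
have := reach_find_parent (inord d) (here (inord d)) (plains v) x i j (out_tape o) du'.
move=> /reach_trans; apply.
rewrite catrevE -map_rev.
have := reach_sweep (inord d) (s := rev (mark_parent (inord d : depth) (rev u))) [::]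
  (here (inord d) :: plains v) x i j o.
rewrite map_rev mark_parent_fst revK size_rev size_mark_parent.
move=> /(_ du)/reach_trans; apply.
apply: reach_step; rewrite /=.
apply: (reach_trans (reach_emit_bits _ [:: _] _ _ _ _ _)).
apply: (reach_trans (reach_child _ _ _ _ _ _ dv)).
rewrite !catrevE cats0 -!plains_rev.
have := reach_back (rev v) (inord d) (plains (rev u)) [::] x i j.
rewrite size_rev catrevE cats0 -plains_rev revK rev_rcons /=.
rewrite /matrix_row left_bits_mark /marked_bits -map_rev Ed -!catA; exact.
Qed.

Lemma reach_matrix u v x i j o : depths (u ++ v) ->
  reach ((size v) * (3 * size (u ++ v) + 6)).+1
    (Conf Here [::] x i j (plains (rev u), plains v) (out_tape o))
    (Conf Tok0 [::] x i j (plains (rev (u ++ v)), [::])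
      (out_tape (o ++ matrix_rows u v))).
Proof.
elim: v u o => [|d v IH] u o Huv.
  by apply: reach_step; rewrite !cats0; exact: reach_refl.
have := reach_trans (reach_matrix_row x i j o Huv) (IH (rcons u d) _ _).
rewrite !cat_rcons -catA => /(_ Huv); apply: reach_le.
by rewrite !size_cat /=; nia.
Qed.

(** * Third phase: the formula *)

Lemma reach_bit b q q' s x i j w o :
  delta q (bit b) (tape_read i) (tape_read j) (tape_read w) None =
    (q', emit_bits s, true, stay, stay, stay, stay) ->
  reach queue_bound.+1 (Conf q [::] (bit b :: x) i j w (out_tape o))
    (Conf q' [::] x i j w (out_tape (o ++ s))).
Proof.
move=> E; apply: reach_step; rewrite /= [tape_read _]/= E /=.
apply: reach_le (reach_emit_bits _ _ _ _ _ _ _).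
have := delta_queue q (bit b) (tape_read i) (tape_read j) (tape_read w) None.
by rewrite E /= size_map.
Qed.

(* Each control step reads one input bit, which pays for the bits it emits. *)
Definition reads (n : nat) (a b : sconfig) : Prop := reach (queue_bound.+1 * n) a b.

Lemma reads_refl a : reads 0 a a.
Proof. exact: reach_refl. Qed.

Lemma reads_trans n m a b c : reads n a b -> reads m b c -> reads (n + m) a c.
Proof. by rewrite /reads mulnDr; exact: reach_trans. Qed.

Lemma reads_bit n b q q' s x i j w o c :
  delta q (bit b) (tape_read i) (tape_read j) (tape_read w) None =
    (q', emit_bits s, true, stay, stay, stay, stay) ->
  reads n (Conf q' [::] x i j w (out_tape (o ++ s))) c ->
  reads n.+1 (Conf q [::] (bit b :: x) i j w (out_tape o)) c.
Proof. by rewrite /reads mulnS => E; apply: reach_trans; exact: reach_bit. Qed.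

Lemma nat_bits_rename n : nat_bits (rename n) = true :: nat_bits n.
Proof.
have [b ->] : exists b : BinNums.N, n = nat_of_bin b by exists (bin_of_nat n); rewrite bin_of_natK.
(* The numeral [b] with a digit 1 added at the low end; zero has no digits and becomes 1. *)
pose b' := if b is BinNums.Npos p then BinNums.Npos (BinNums.xI p) else BinNums.Npos BinNums.xH.
have Eb : rename b = nat_of_bin b' by case: b @b' => //= p; rewrite /rename natTrecE.
by rewrite /nat_bits Eb !nat_of_binK; case: b @b' {Eb}.
Qed.

Lemma reads_variable r n x i j w o :
  reads (size (encode_token (KVar n)))
    (Conf (Var r) [::] (bits (encode_token (KVar n)) ++ x) i j w (out_tape o))
    (Conf (after_variable r).1 [::] x i j w
      (out_tape (o ++ encode_token (KVar (rename n)) ++ (after_variable r).2))).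
Proof.
rewrite /= nat_bits_rename /=; apply: reads_bit; first by [].
rewrite -[o ++ [:: _, _, _ & _ ++ _]]/(o ++ [:: false; true; true] ++ _) (catA o).
move: (o ++ _) => {}o.
elim: (nat_bits n) o => [|b s IH] o /=.
  apply: reads_bit; first by [].
  exact: reads_refl.
apply: (@reads_bit _ true _ (VarBit r) [::]); first by [].
rewrite cats0; apply: (@reads_bit _ _ _ _ [:: true; b]); first by case: b.
by have := IH (o ++ [:: true; b]); rewrite -!catA.
Qed.

Lemma encode_word_cat s t : encode_word (s ++ t) = encode_word s ++ encode_word t.
Proof. by rewrite /encode_word map_cat flatten_cat. Qed.

Lemma encode_translate_atom e a b :
  encode_word (word (translate_atom e a b)) =
  (opening ++ encode_token (KVar (rename a)) ++ middle) ++
    encode_token (KVar (rename b)) ++ closing e.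
Proof.
rewrite /opening /middle /closing -!lock.
have E k s : encode_token k ++ s = encode_word [:: k] ++ s by rewrite /encode_word /= cats0.
by rewrite !E -!encode_word_cat.
Qed.

Lemma reads_atom e a b x i j w o :
  reads (size (encode_token (KVar a) ++ encode_token (KVar b)))
    (Conf (Var (Some (e, false))) [::]
      (bits (encode_token (KVar a) ++ encode_token (KVar b)) ++ x) i j w
      (out_tape (o ++ opening)))
    (Conf Tok0 [::] x i j w
      (out_tape (o ++ encode_formula (translate_atom e a b)))).
Proof.
rewrite size_cat bits_cat -catA.
apply: (reads_trans (reads_variable (Some (e, false)) _ _ _ _ _ _)).
have := reads_variable (Some (e, true)) b x i j w
  ((o ++ opening) ++ encode_token (KVar (rename a)) ++ middle).
by rewrite /encode_formula -/(encode_word _) encode_translate_atom -!catA.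
Qed.

Lemma reads_true n q q' x i j w o c :
  delta q (bit true) (tape_read i) (tape_read j) (tape_read w) None =
    (q', [::], true, stay, stay, stay, stay) ->
  reads n (Conf q' [::] x i j w (out_tape o)) c ->
  reads n.+1 (Conf q [::] (bit true :: x) i j w (out_tape o)) c.
Proof. by move=> E H; apply: (@reads_bit _ _ _ _ [::]) E _; rewrite cats0. Qed.

(** In Polish notation the machine is back in [Tok0] after every complete subformula, whatever
    follows on the input, so the induction needs no stack. *)
Lemma reads_formula phi x i j w o : is_FO phi ->
  reads (size (encode_formula phi))
    (Conf Tok0 [::] (bits (encode_formula phi) ++ x) i j w (out_tape o))
    (Conf Tok0 [::] x i j w (out_tape (o ++ encode_formula (translate phi)))).
Proof.
elim: phi x o => [a b|a b|phi IH|phi IHl psi IHr|y phi IH|t1 t2] x o //.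
- move=> _; have := reads_atom false a b x i j w o.
  rewrite -[encode_token (KVar b)]cats0 => H.
  apply: reads_true; first by [].
  by apply: (@reads_bit _ false _ (Var (Some (false, false))) opening).
- move=> _; have := reads_atom true a b x i j w o.
  rewrite -[encode_token (KVar b)]cats0 => H.
  do 2![apply: reads_true; first by []].
  by apply: (@reads_bit _ false _ (Var (Some (true, false))) opening).
- move=> /IH{}IH; do 3![apply: reads_true; first by []].
  apply: (@reads_bit _ false _ Tok0 (encode_token KNot)); first by [].
  by have := IH x (o ++ encode_token KNot); rewrite -catA; exact.
- move=> /= /andP [/IHl{}IHl /IHr{}IHr].
  have H := reads_trans (IHl _ _) (IHr x _).
  do 4![apply: reads_true; first by []].
  apply: (@reads_bit _ false _ Tok0 (encode_token KOr)); first by [].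
  have := H (o ++ encode_token KOr).
  rewrite catA -bits_cat -size_cat -!catA -!encode_word_cat; exact.
- move=> /IH{}IH; do 5![apply: reads_true; first by []].
  apply: (@reads_bit _ false _ (Var None) (encode_token KExists)); first by [].
  have := reads_trans (reads_variable None y _ i j w _) (IH x _).
  move=> /(_ (o ++ encode_token KExists)).
  by rewrite catA -bits_cat -size_cat cats0 -(catA (o ++ _)) -(catA o); exact.
Qed.

Lemma depths_tree rows : depths (tree_word rows).
Proof.
have dn k d : d < 4 -> depths (nseq k d) by move=> d4; rewrite /depths all_nseq d4 orbT.
have dcat u v : depths (u ++ v) = depths u && depths v by exact: all_cat.
have dc j s : depths (column_word j s).
  elim: s j => //= b s IH j; rewrite dcat IH andbT.
  by case: b => //; exact: (dn j.+1).
suff dr i : depths (row_word i rows) by exact: dr 0.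
elim: rows i => // s rows IH i.
rewrite -[row_word _ _]/((1 :: nseq i.+1 2) ++ column_word 0 s ++ row_word i.+1 rows).
by rewrite !dcat dc IH !andbT; exact: (dn i.+1).
Qed.

Lemma size_matrix_row u d v : size (matrix_row u d v) = size u + (size v).+1.
Proof.
rewrite size_cat size_rev left_bits_mark size_map size_mark_parent size_rev /=.
congr (_ + _.+1); elim: v => //= x v IH; case: ifP => //= _.
  by rewrite size_nseq.
by rewrite IH.
Qed.

Lemma size_matrix_rows u v : size (matrix_rows u v) = size v * (size u + size v).
Proof.
elim: v u => //= d v IH u; rewrite size_cat size_matrix_row IH size_rcons; lia.
Qed.

(** * The complete run *)

Definition reduction_output (rows : seq (seq bool)) (phi : formula) : seq bool :=
  unary (size (tree_word rows)) ++ matrix_rows [::] (tree_word rows) ++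
  encode_formula (translate phi).

(** For n vertices, m nodes, k bits of formula and l bits of output, the summands pay for loading,
    the rows of the graph, the end of that phase, rewinding W, the tree matrix, the formula, and
    rewinding the output. *)
Definition reduction_time (n m k l : nat) : nat :=
  (n + 4) + (n * (3 * n + 7 + n * (3 * n + 8)) + (n + 2 + (m.+1 +
  ((m * (3 * m + 6)).+1 + (queue_bound.+1 * k + l.+2))))).

Lemma reach_output l r x i j w :
  reach (size l).+1
    (Conf ORewind [::] x i j w (move_tape left_ (bits l, r)))
    (Conf Halt [::] x i j w ([::], catrev (bits l) r)).
Proof.
elim: l r => [|b l IH] r.
  by apply: reach_step; case: r => [|c r]; exact: reach_refl.
by apply: reach_step; exact: (IH (bit b :: r)).
Qed.

Lemma reach_reduction n rows phi : 0 < n -> size rows = n ->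
  all (fun s => size s == n) rows -> is_FO phi ->
  let t0 : tape symbol := ([::], [::]) in
  exists i j w,
  reach (reduction_time n (size (tree_word rows)) (size (encode_formula phi))
      (size (reduction_output rows phi)))
    (Conf Load [::] (bits (unary n ++ flatten rows ++ encode_formula phi)) t0 t0 t0 t0)
    (Conf Halt [::] [::] i j w ([::], bits (reduction_output rows phi))).
Proof.
move=> n_gt0 size_rows rows_n FOphi t0.
exists ([::], None :: bits (nseq n true)), (counter 0 n), (plains (rev (tree_word rows)), [::]).
rewrite /unary -cats1 -!catA bits_cat /reduction_time.
rewrite -(addnA n 4); apply: reach_trans.
  by have := reach_load n 0 _ t0 t0; rewrite addn0; apply.
rewrite [4 + _]addSn; apply: reach_step; rewrite [sstep _]/=.
apply: (reach_trans (reach_emit_depths RowNext [:: 0; 1; 2] _ _ _ [::])).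
rewrite bits_cat.
have := reach_rows 0 (bits (encode_formula phi)) [:: 0; 1; 2] n_gt0 rows_n.
rewrite size_rows add0n => /reach_trans; apply.
rewrite -[_ ++ row_word 0 rows]/(tree_word rows) /reduction_output.
move: (tree_word rows) (depths_tree rows) => W dW.
have Erw : rewound n 0 = ([::], None :: bits (nseq n true)) by case: n n_gt0 {rows_n size_rows}.
rewrite -(addnA n 2); apply: (reach_trans (reach_counter_I _ _ _ _ _ _)); rewrite {}Erw.
rewrite [2 + _]addSn; apply: reach_step; rewrite [sstep _]/=.
apply: (reach_trans (reach_emit_bits _ [:: false] _ _ _ _ _)).
have := reach_W_rewind (rev W) [::].
rewrite size_rev => H; apply: (reach_trans (H _ _ _ _)) => {H}.
rewrite -/(rev (plains (rev W))) -plains_rev revK.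
apply: (reach_trans (@reach_matrix [::] W _ _ _ _ dW)).
have := reads_formula [::] _ (counter 0 n) (plains (rev W), [::]) _ FOphi.
rewrite cats0 => H; apply: (reach_trans (H _ _)) => {H}.
apply: reach_step; rewrite [sstep _]/=.
rewrite cats1 -!catA -/(unary _).
move: (_ ++ _) => O.
have := reach_output (rev O) [::].
by rewrite size_rev catrevE cats0 /bits map_rev revK; apply.
Qed.

Lemma sim_iter k c a : sim c a -> sim (iter k (@step transducer) c) (iter k sstep a).
Proof. by move=> H; elim: k => //= k; exact: sim_step. Qed.

Lemma sim_initial s :
  sim (initial transducer s)
    (Conf Load [::] (bits s) ([::], [::]) ([::], [::]) ([::], [::]) ([::], [::])).
Proof.
have tn k : k < 5 -> (tape_no k == ord0) = (k == 0).
  by move=> ?; rewrite -val_eqE /= /tape_no inordK.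
split=> //=; first by rewrite /insub_bseq /insubd insubT.
  by rewrite ffunE tn.
by split; rewrite ffunE tn.
Qed.

Lemma leading_bits_strip (s : seq (cell symbol)) : leading_bits (strip s) = leading_bits s.
Proof.
elim: s => //= -[[b|g]|] s /= IH; first by rewrite IH.
- by [].
- by case: (strip s).
Qed.

Lemma leading_bits_bits s : leading_bits (bits s) = s.
Proof. by elim: s => //= b s ->. Qed.

(** [step] fixes halting configurations, so a run that halts early shows the same output at time
    [T]. *)
Lemma transducer_outputs n T s s' i j w :
  reach n (Conf Load [::] (bits s) ([::], [::]) ([::], [::]) ([::], [::]) ([::], [::]))
    (Conf Halt [::] [::] i j w ([::], bits s')) ->
  n <= T -> outputs_within transducer s s' T.
Proof.
case=> m le_mn E le_nT; have := sim_iter m (sim_initial s); rewrite {}E.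
set c := iter m _ _ => /= -[Eq Es _ [_ _ _ [_ Eo]]].
have Hc : halting (m := transducer) c.1 by apply/andP; split; [exact/eqP | exact/nilP].
have Ec : iter T (@step transducer) (initial transducer s) = c.
  rewrite -(subnK (leq_trans le_mn le_nT)) iterD -/c.
  by elim: (T - m) => //= k ->; rewrite /step Hc.
rewrite /outputs_within Ec; split=> //.
have E4 : ord_max = tape_no 4 by apply/val_inj; rewrite /= /tape_no inordK.
rewrite /output [ord_max]E4 -leading_bits_strip [strip _]Eo.
by rewrite leading_bits_strip leading_bits_bits.
Qed.

(** * Polynomial bounds *)

Definition polynomial_fun (f : nat -> nat) : Prop :=
  exists p : {poly nat}, forall n, p.[n]%R = f n.

Lemma polynomial_cst c : polynomial_fun (fun=> c).
Proof. by exists (c%:P)%R => n; rewrite hornerC. Qed.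

Lemma polynomial_id : polynomial_fun (fun n => n).
Proof. by exists 'X%R => n; rewrite hornerX. Qed.

Lemma polynomial_add f g :
  polynomial_fun f -> polynomial_fun g -> polynomial_fun (fun n => f n + g n).
Proof. by move=> [p Ep] [q Eq]; exists (p + q)%R => n; rewrite hornerD Ep Eq. Qed.

Lemma polynomial_mul f g :
  polynomial_fun f -> polynomial_fun g -> polynomial_fun (fun n => f n * g n).
Proof. by move=> [p Ep] [q Eq]; exists (p * q)%R => n; rewrite hornerM Ep Eq. Qed.

Lemma polynomial_succ f : polynomial_fun f -> polynomial_fun (fun n => (f n).+1).
Proof.
move=> Hf; have [p Ep] := polynomial_add (polynomial_cst 1) Hf.
by exists p => n; rewrite Ep.
Qed.

Ltac polynomial_tac :=
  repeat first [exact: polynomial_id | exact: polynomial_cst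
    | apply: polynomial_succ | apply: polynomial_add | apply: polynomial_mul].

(** The prefix has three entries; each row has its own node, at most n leaves, and at most n column
    nodes with at most n leaves each. *)
Definition word_bound (n : nat) : nat := 3 + n * (1 + n + n * (n + 1)).

Lemma size_column_word j s : size (column_word j s) <= size s * (j + size s + 1).
Proof.
elim: s j => //= b s IH j; rewrite size_cat mulSn.
apply: leq_add; first by case: b => //=; rewrite size_nseq; lia.
by apply: leq_trans (IH _) _; rewrite leq_mul //; lia.
Qed.

Lemma size_tree_word n rows : size rows = n -> all (fun s => size s == n) rows ->
  size (tree_word rows) <= word_bound n.
Proof.
move=> size_rows rows_n; rewrite /= -[_.+3]/(3 + _) leq_add2l.
suff H i : size (row_word i rows) <= size rows * (1 + (i + size rows) + n * (n + 1)).
  by have := H 0; rewrite size_rows.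
elim: rows i rows_n {size_rows} => // s rows IH i /= /andP [/eqP size_s /IH{}IH].
have := size_column_word 0 s; rewrite size_s => Hs.
rewrite size_cat size_nseq size_cat mulSn.
have := leq_add Hs (IH i.+1); rewrite addSnnS; nia.
Qed.

Lemma size_encode_rename x :
  size (encode_token (KVar (rename x))) = size (encode_token (KVar x)) + 2.
Proof. by rewrite /= nat_bits_rename /=; lia. Qed.

Lemma size_encode_cons k s :
  size (encode_word (k :: s)) = size (encode_token k) + size (encode_word s).
Proof. exact: size_cat. Qed.

(** Bits are counted here because the output length enters the running time. The tag of an atom has
    at least two bits, which pay for the fixed blocks and for the four bits that renaming two
    variables adds. *)
Lemma size_encode_translate phi : is_FO phi ->
  size (encode_formula (translate phi)) <= queue_bound * size (encode_formula phi).
Proof.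
have arith o m t f : o + m + t <= 6 + o + m + t + f /\ o + m + f <= 6 + o + m + t + f by lia.
have ge_atom e : size opening + size middle + size (closing e) <= queue_bound.
  by have [] := arith (size opening) (size middle) (size (closing true))
    (size (closing false)); case: e.
have ge6 : 6 <= queue_bound by rewrite /queue_bound -!addnA; exact: leq_addr.
have atom e a b :
    size (encode_formula (translate_atom e a b)) <=
    queue_bound * (2 + (size (encode_token (KVar a)) + size (encode_token (KVar b)))).
  rewrite /encode_formula -/(encode_word _) encode_translate_atom.
  move: (encode_token (KVar (rename a))) (encode_token (KVar (rename b)))
    (size_encode_rename a) (size_encode_rename b).
  move: (size (encode_token (KVar a))) (size (encode_token (KVar b))) => sa sb ra rb Ea Eb.
  rewrite !size_cat {}Ea {}Eb.
  have : sa + sb <= queue_bound * (sa + sb) by rewrite leq_pmull // (leq_trans _ ge6).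
  rewrite mulnDr; move: ge6 (ge_atom e); move: (queue_bound * (sa + sb)).
  by move: queue_bound (size opening) (size middle) (size (closing e)) => *; lia.
have six m n p : p <= queue_bound * m -> n + p <= queue_bound * (n + m).
  by move: queue_bound ge6 => ? ? ?; nia.
elim: phi => [a b|a b|phi IH|phi IHl psi IHr|y phi IH|t1 t2] //.
- move=> _; apply: leq_trans (atom _ _ _) _; rewrite leq_mul2l; apply/orP; right.
  by rewrite /encode_formula -/(encode_word _) !size_encode_cons addn0.
- move=> _; apply: leq_trans (atom _ _ _) _; rewrite leq_mul2l; apply/orP; right.
  by rewrite /encode_formula -/(encode_word _) !size_encode_cons addn0 leq_add2r.
- move=> /IH{}IH; rewrite /encode_formula -!/(encode_word _) [word _]/= [word (Not _)]/=.
  by rewrite !size_encode_cons six.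
- move=> /andP [/IHl{}IHl /IHr{}IHr].
  rewrite /encode_formula -!/(encode_word _) [word _]/= [word (Or phi _)]/=.
  rewrite !size_encode_cons six //.
  by rewrite !encode_word_cat !size_cat mulnDr leq_add.
- move=> /IH{IH}; rewrite /encode_formula -!/(encode_word _).
  rewrite [word (translate (Exists _ _))]/= [word (Exists _ phi)]/= !size_encode_cons => IH.
  rewrite six // size_encode_rename.
  have : 0 < size (encode_token (KVar y)) by []; move: IH.
  move: (size (encode_token _)) (size (encode_word _)) (size (encode_word _)).
  by move: queue_bound ge6 => *; nia.
Qed.

(** An atom of three tokens becomes 18 tokens plus those of [core]; renaming is free, and
    connectives and quantifiers keep their tokens. *)
Lemma size_word_translate phi : is_FO phi ->
  formula_size (translate phi) <=
    (17 + (size (word (core true)) + size (word (core false)))) * formula_size phi.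
Proof.
rewrite /formula_size.
have atom e a b : size (word (translate_atom e a b)) = 18 + size (word (core e)) by [].
have [m Em] : {m | m = size (word (core true)) + size (word (core false))} by eexists.
have lem e : size (word (core e)) <= m by rewrite Em; case: e; rewrite ?leq_addl ?leq_addr.
rewrite -{}Em.
elim: phi => [a b|a b|phi IH|phi IHl psi IHr|y phi IH|t1 t2] //.
- rewrite [translate _]/= atom -[size (word (Equal a b))]/3 => _.
  by move: (size _) (lem false) => *; lia.
- rewrite [translate _]/= atom -[size (word (Edge a b))]/3 => _.
  by move: (size _) (lem true) => *; lia.
- by move=> /IH{}IH /=; nia.
- by move=> /andP [/IHl{}IHl /IHr{}IHr]; rewrite /= !size_cat; nia.
- by move=> /IH{}IH /=; nia.
Qed.

(** * The reduction *)

Definition graph_rows (A : structure) : seq (seq bool) :=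
  [seq [seq edge i j | j <- enum (universe A)] | i <- enum (universe A)].

Definition graph_tree (A : structure) : structure :=
  word_structure (tree_word (graph_rows A)).

Lemma size_graph_rows A : size (graph_rows A) = (max_elt A).+1.
Proof. by rewrite size_map size_enum_ord. Qed.

Lemma graph_rows_square A : all (fun s => size s == (max_elt A).+1) (graph_rows A).
Proof. by apply/allP => s /mapP [i _ ->]; rewrite size_map size_enum_ord. Qed.

Lemma encode_graph A :
  encode_structure A = unary (max_elt A).+1 ++ flatten (graph_rows A).
Proof. by rewrite /encode_structure card_ord. Qed.

Lemma nth_graph_rows A (a b : universe A) :
  nth false (nth [::] (graph_rows A) a) b = edge a b.
Proof.
by rewrite (nth_map a) ?size_enum_ord // (nth_map a) ?size_enum_ord // !nth_ord_enum.
Qed.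

(** The tree records a graph edge from a row node down to a column node, whereas a tree edge can be
    read both ways; the upward reading is absorbed by the symmetry of the graph. *)
Lemma graph_tree_represents A : is_graph A -> represents A (graph_tree A).
Proof.
move=> [symA _]; set rows := graph_rows A.
have tw : tree_like (tree_word rows) := tree_like_tree_word rows.
have size_rows : size rows = (max_elt A).+1 := size_graph_rows A.
have rows_n : all (fun s => size s == (max_elt A).+1) rows := graph_rows_square A.
have rows_le : all (fun s => size s <= (max_elt A).+1) rows.
  by apply: sub_all rows_n => s /eqP ->.
have root : 1 < size (children (tree_word rows)).
  by have [-> _] := children_tree rows; rewrite size_rows.
have lab (u : universe (graph_tree A)) :
    leaf_neighbours u = leaf_children (drop u (tree_word rows)).
  exact: leaf_neighbours_word.
have edge_linked (a b : universe A) : edge a b <-> exists2 r, r < size (tree_word rows) &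
    linked a b (drop r (tree_word rows)).
  by rewrite -(nth_graph_rows a b) -(somewhere_linked a b rows_le); split=> /somewhereP.
have linkedP (a b : universe A) (u : universe (graph_tree A)) :
    linked a b (drop u (tree_word rows)) <->
    leaf_neighbours u = a.+1 /\ exists2 v : universe (graph_tree A),
      down (tree_word rows) u v & leaf_neighbours v = b.+1.
  rewrite /linked lab has_count -card_children //; split.
    move=> /andP [/eqP Ea /card_gt0P [v]]; rewrite inE => /andP [D /eqP Eb].
    by split=> //; exists v; rewrite ?lab.
  move=> [-> [v D Eb]]; rewrite eqxx; apply/card_gt0P; exists v.
  by rewrite inE D -lab Eb eqxx.
split=> [a|u|a b].
- have : somewhere (fun s => leaf_children s == a.+1) (tree_word rows).
    by apply: somewhere_label; rewrite size_rows.
  by case/somewhereP=> r lt_r /eqP E; exists (Ordinal lt_r : universe (graph_tree A)); rewrite lab.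
- by rewrite lab; apply: leaf_children_bound.
split.
  case/edge_linked=> r lt_r /(linkedP _ _ (Ordinal lt_r)) [Ea [v D Eb]].
  by exists (Ordinal lt_r : universe (graph_tree A)), v; split=> //; apply/orP; left.
case=> p [q [/orP [D|D] Ep Eq]].
  apply/edge_linked; exists (val p); first exact: ltn_ord.
  by apply/linkedP; split=> //; exists q.
rewrite symA; apply/edge_linked; exists (val q); first exact: ltn_ord.
by apply/linkedP; split=> //; exists p.
Qed.

Definition reduction (I : structure * formula) : structure * formula :=
  (graph_tree I.1, translate I.2).

Lemma size_rcons_unary n : size (unary n) = n.+1.
Proof. by rewrite size_rcons size_nseq. Qed.

Definition output_bound (k m : nat) : nat := m.+1 + (m * m + queue_bound * k).

Lemma size_reduction_output rows phi : is_FO phi ->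
  size (reduction_output rows phi) <=
  output_bound (size (encode_formula phi)) (size (tree_word rows)).
Proof.
move=> FOphi; rewrite /reduction_output 2!size_cat size_rcons_unary.
by rewrite /output_bound !leq_add // ?size_matrix_rows ?size_encode_translate.
Qed.

Definition time_bound (s : nat) : nat :=
  reduction_time s (word_bound s) s (output_bound s (word_bound s)).

Lemma polynomial_time_bound : polynomial_fun time_bound.
Proof. by rewrite /time_bound /reduction_time /output_bound /word_bound; polynomial_tac. Qed.

Lemma reduction_time_mono n n' m m' k k' l l' :
  n <= n' -> m <= m' -> k <= k' -> l <= l' ->
  reduction_time n m k l <= reduction_time n' m' k' l'.
Proof.
move=> *; rewrite /reduction_time.
by repeat first [assumption | exact: leqnn | apply: leq_add | apply: leq_mul | rewrite ltnS].
Qed.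

Lemma word_bound_mono n n' : n <= n' -> word_bound n <= word_bound n'.
Proof.
move=> *; rewrite /word_bound.
by repeat first [assumption | exact: leqnn | apply: leq_add | apply: leq_mul].
Qed.

Lemma reduction_polytime : polytime_on (mc_instance FO is_graph) reduction.
Proof.
have [p Ep] := polynomial_time_bound.
exists transducer, p => -[A phi] [_ FOphi _] /=; rewrite Ep.
have [i [j [w H]]] := reach_reduction (ltn0Sn _) (size_graph_rows A) (graph_rows_square A) FOphi.
have E : encode (reduction (A, phi)) = reduction_output (graph_rows A) phi.
  by rewrite /encode /= encode_word_structure // -catA.
rewrite E {1}/encode /= encode_graph -catA.
apply: (transducer_outputs H).
have le_n : (max_elt A).+1 <= size (encode (A, phi)).
  by rewrite /encode /= encode_graph !size_cat size_rcons_unary; lia.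
have le_k : size (encode_formula phi) <= size (encode (A, phi)).
  by rewrite /encode size_cat leq_addl.
have le_m : size (tree_word (graph_rows A)) <= word_bound (size (encode (A, phi))).
  apply: leq_trans (word_bound_mono le_n).
  exact: size_tree_word (size_graph_rows A) (graph_rows_square A).
apply: reduction_time_mono => //.
apply: leq_trans (size_reduction_output _ FOphi) _; rewrite /output_bound.
by repeat first [assumption | exact: leqnn | apply: leq_add | apply: leq_mul | rewrite ltnS].
Qed.

Theorem theorem4p1 :
  exists f : structure * formula -> structure * formula,
    polynomial_fpt_reduction FO is_graph FOC is_tree f.
Proof.
exists reduction; split.
- exact: reduction_polytime.
- move=> [A phi] [_ FOphi closed]; split=> //=.
    exact: word_structure_tree (tree_like_tree_word _).
  by rewrite /sentence free_vars_translate // /nilp size_map.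
- by move=> [A phi] [graphA FOphi _]; exact: models_translate (graph_tree_represents graphA) FOphi.
- have [p Ep] : polynomial_fun (fun s => word_bound s + word_bound s * word_bound s).
    by rewrite /word_bound; polynomial_tac.
  exists p => -[A phi] _; rewrite Ep [(reduction _).1]/= [(A, phi).1]/=.
  have le_n : (max_elt A).+1 <= struct_size A by rewrite /struct_size card_ord leq_addr.
  have le_m := leq_trans (size_tree_word (size_graph_rows A) (graph_rows_square A))
    (word_bound_mono le_n).
  rewrite {1}/struct_size card_word_structure //; apply: leq_add => //.
  apply: leq_trans (max_card _) _; rewrite card_prod card_word_structure //.
  exact: leq_mul.
exists ((17 + (size (word (core true)) + size (word (core false))))%:P * 'X)%R.
move=> [A phi] [_ FOphi _]; rewrite hornerM hornerC hornerX; exact: size_word_translate.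
Qed.
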